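(* Let $X,Y$ be Polish spaces, $\mu\in\mathcal{P}(X)$, $\nu\in\mathcal{P}(Y)$, and $\mathbb{P}\in\mathcal{P}(X\times Y)$ with $\mathbb{P}\sim\mu\otimes\nu$. Let $h:[0,\infty)\to(-\infty,\infty)$ be continuous, twice continuously differentiable on $(0,\infty)$, with $\lim_{x\to 0}h'(x)=-\infty$, $\lim_{x\to+\infty}h'(x)=+\infty$ and $\inf_{(0,\infty)}h''>-\infty$. Assume that the problem $$\inf\left\{\int_{X\times Y}h\Big(\frac{d\mathbb{Q}}{d\mathbb{P}}(x,y)\Big)\,\mathbb{P}(dx,dy):\ \mathbb{Q}\in\mathrm{cpl}(\mu,\nu)\right\}$$ has finite value and that $\mathbb{Q}^*$ is an optimizer thereof. Then $\mathbb{Q}^*\sim\mathbb{P}$ and there exist measurable functions $\phi:X\to[-\infty,+\infty)$ and $\psi:Y\to[-\infty,+\infty)$ such that $$h'\circ\frac{d\mathbb{Q}^*}{d\mathbb{P}}(x,y)=\phi(x)+\psi(y)\qquad\mathbb{P}\text{-a.s.}$$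
   Context: $\mathcal{P}(\cdot)$ denotes the set of Borel probability measures. $\mathrm{cpl}(\mu,\nu)$ is the set of Borel probability measures on $X\times Y$ with $X$-marginal $\mu$ and $Y$-marginal $\nu$. The objective functional is understood to be $+\infty$ when $\mathbb{Q}\not\ll\mathbb{P}$. $\rho\sim\eta$ means $\rho\ll\eta$ and $\eta\ll\rho$. The value $h'(0)$ is $\lim_{x\searrow 0}h'(x)$. *)

(* Defs.v *)
From HB Require Import structures.
From mathcomp Require Import all_boot all_order all_algebra.
From mathcomp Require Import all_classical all_reals all_analysis.

Set Implicit Arguments.
Unset Strict Implicit.
Unset Printing Implicit Defensive.
Import Order.TTheory GRing.Theory Num.Theory.
Import numFieldNormedType.Exports.
Local Open Scope ring_scope.
Local Open Scope classical_set_scope.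

Definition separable_space (T : topologicalType) : Prop :=
  exists2 D : set T, countable D & dense D.

Definition completely_metrizable (R : realType) (T : topologicalType) : Prop :=
  exists (M : metricType R) (f : T -> M) (g : M -> T),
    [/\ cancel f g, cancel g f, continuous f, continuous g &
        forall F : set_system M, ProperFilter F -> cauchy F ->
          exists p : M, F --> p].

Definition polish (R : realType) (T : topologicalType) : Prop :=
  separable_space T /\ completely_metrizable R T.

(* A notation, not a definition, so that canonical structures are inferred. *)
Notation borel T := (g_sigma_algebraType (@open T)).

Lemma polish_second_countable (R : realType) (T : topologicalType) :
  polish R T -> @second_countable T.
Proof.
move=> [[D cD dD] [M [f [g [fK gK cf cg _]]]]].
pose B (x : T) (n : nat) : set T := f @^-1` (ball (f x) n.+1%:R^-1)°.
have oB x n : open (B x n).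
  by apply: open_comp; [move=> ? _; exact: cf | exact: open_interior].
exists [set B x n | x in D & n in setT].
  have -> : [set B x n | x in D & n in setT] =
      (fun p => B p.1 p.2) @` (D `*` [set: nat]).
    by apply/seteqP; split=> [_ [x Dx [n _ <-]]|_ [[x n] [Dx _] <-]];
      [exists (x, n)|exists x => //; exists n].
  apply: (sub_countable (card_image_le _ _)).
  by apply: countableX.
split=> [_ [x _ [n _ <-]]//|x U].
rewrite nbhs_simpl nbhsE => -[V [oV Vx] VU].
have : nbhs (f x) (g @^-1` V).
  by apply: cg; rewrite fK; apply: open_nbhs_nbhs.
rewrite -nbhs_ballE => -[e /= e0 eV].
have [n ne] : exists n, n.+1%:R^-1 + n.+1%:R^-1 <= e.
  pose n := Num.truncn (2 / e); exists n.
  rewrite -mulr2n -[leLHS]mulr_natl ler_pdivrMr ?ltr0n//.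
  by rewrite mulrC -ler_pdivrMr// ltW// truncnS_gt.
have n0 : 0 < n.+1%:R^-1 :> R by rewrite invr_gt0 ltr0n.
have [y [yB Dy]] : (B x n `&` D) !=set0.
  by apply: dD => //; exists x; rewrite /B/=; exact: nbhsx_ballx.
exists (B y n) => /=.
  split; first by exists y => //; exists n.
  rewrite /B /= ; move: yB => /= /interior_subset /ball_sym.
  rewrite ballEmdist /= => yx; rewrite /interior.
  apply/nbhs_ballP; exists (n.+1%:R^-1 - mdist (f y) (f x)) => /=.
    by rewrite subr_gt0.
  move=> z; rewrite !ballEmdist /= => xz.
  by rewrite (le_lt_trans (metric_triangle _ (f x) _))// -ltrBrDl.
move=> z /= /interior_subset yz; apply: VU; rewrite -(fK z).
apply: eV; apply: (le_ball ne); apply: (ball_triangle _ yz).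
exact: interior_subset yB.
Qed.

(* The product measurable space [borel X * borel Y] carries exactly the Borel
   sigma-algebra of the product topology when X and Y are Polish. *)
Lemma measurable_borel_prod (T1 T2 : ptopologicalType) :
  @second_countable T1 -> @second_countable T2 ->
  (measurable : set (set (borel T1 * borel T2))) =
  <<s @open (T1 * T2)%type >>.
Proof.
move=> [B1 cB1 [B1o B1b]] [B2 cB2 [B2o B2b]].
apply/seteqP; split.
  apply: smallest_sub; first exact: smallest_sigma_algebra.
  rewrite subUset; split=> _ [A mA <-]; rewrite setTI.
    pose G := [set A : set T1 | <<s @open (T1 * T2)%type >> (fst @^-1` A)].
    have : <<s @open T1 >> `<=` G.
      apply: smallest_sub.
        split; rewrite /G /=.
        - by rewrite preimage_set0; exact: sigma_algebra0.
        - by move=> C GC; rewrite setTD preimage_setC -setTD; exact: sigma_algebraCD.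
        - by move=> F GF; rewrite preimage_bigcup; exact: sigma_algebra_bigcup.
      move=> U oU; apply: sub_sigma_algebra.
      by apply: open_comp => // ? _; exact: cvg_fst.
    exact.
  pose G := [set A : set T2 | <<s @open (T1 * T2)%type >> (snd @^-1` A)].
  have : <<s @open T2 >> `<=` G.
    apply: smallest_sub.
      split; rewrite /G /=.
      - by rewrite preimage_set0; exact: sigma_algebra0.
      - by move=> C GC; rewrite setTD preimage_setC -setTD; exact: sigma_algebraCD.
      - by move=> F GF; rewrite preimage_bigcup; exact: sigma_algebra_bigcup.
    move=> U oU; apply: sub_sigma_algebra.
    by apply: open_comp => // ? _; exact: cvg_snd.
  exact.
apply: smallest_sub; first exact: sigma_algebra_measurable.
move=> U oU.
pose I := [set p : set T1 * set T2 | [/\ B1 p.1, B2 p.2 & p.1 `*` p.2 `<=` U]].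
have -> : U = \bigcup_(p in I) (p.1 `*` p.2).
  apply/seteqP; split=> [[x y] Uxy|z [p [_ _ pU] pz]]; last exact: pU.
  have /= := open_nbhs_nbhs (conj oU Uxy).
  move=> [[/= V W] [/B1b[V' [BV' V'x] VV'] /B2b[W' [BW' W'y] WW']] VWU].
  exists (V', W') => //; split=> // -[a b] [/= /VV' ? /WW' ?].
  exact: VWU.
rewrite bigcup_set_type; apply: countable_bigcupT_measurable.
  rewrite (eq_countable (card_setT _)).
  apply: (sub_countable _ (countableX cB1 cB2)).
  by apply: subset_card_le => p [].
move=> [p /set_mem [p1 p2 _]] /=.
by apply: measurableX; apply: sub_sigma_algebra; [exact: B1o|exact: B2o].
Qed.

Section coupling.
Context (R : realType) (X Y : ptopologicalType).
Implicit Types P Q : probability (borel X * borel Y)%type R.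

Definition cpl (mu : probability (borel X) R) (nu : probability (borel Y) R) :
    set (probability (borel X * borel Y)%type R) :=
  [set Q : probability (borel X * borel Y)%type R |
    (forall A : set (borel X), measurable A -> pushforward Q fst A = mu A) /\
    (forall B : set (borel Y), measurable B -> pushforward Q snd B = nu B)].

(* The density dQ/dP. Among the library's versions of the Radon-Nikodym
   derivative we take the one for finite measures, which is finite and
   nonnegative everywhere and not only almost everywhere. Only meaningful when
   Q << P. *)
Definition density Q P (z : X * Y) : R := fine (Radon_Nikodym_SigmaFinite.f Q P z).

Lemma density_ge0 Q P z : Q `<< P -> 0 <= density Q P z.
Proof. by move=> QP; apply/fine_ge0/Radon_Nikodym_SigmaFinite.f_ge0. Qed.

Lemma density_integral Q P (A : set (borel X * borel Y)) :
  Q `<< P -> measurable A -> Q A = (\int[P]_(z in A) (density Q P z)%:E)%E.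
Proof.
move=> QP mA; rewrite (Radon_Nikodym_SigmaFinite.f_integral QP mA).
apply: eq_integral => z _; rewrite /density fineK//.
exact: Radon_Nikodym_SigmaFinite.f_fin_num.
Qed.

Definition objective (h : R -> R) P Q : \bar R :=
  if `[< Q `<< P >] then (\int[P]_z (h (density Q P z))%:E)%E else +oo%E.

Definition problem_value (h : R -> R) P mu nu : \bar R :=
  ereal_inf [set objective h P Q | Q in cpl mu nu].

Definition optimizer (h : R -> R) P mu nu Q : Prop :=
  cpl mu nu Q /\ objective h P Q = problem_value h P mu nu.

End coupling.

Definition equivalent_measures d (T : measurableType d) (R : realType)
    (m1 m2 : set T -> \bar R) : Prop := m1 `<< m2 /\ m2 `<< m1.

(* h' on [0, +oo[, where h'(0) is the limit of h' at 0 from the right. *)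
Definition derive_ext (R : realType) (h : R -> R) (x : R) : \bar R :=
  if x == 0 then lim ((h^`()%classic t)%:E @[t --> 0^'+]) else (h^`()%classic x)%:E.

Definition C2_pos (R : realType) (h : R -> R) : Prop :=
  [/\ {in `]0, +oo[, forall x, derivable h x 1},
      {in `]0, +oo[, forall x, derivable h^`() x 1} &
      {in `]0, +oo[, continuous h^`(2)}].

(* Main.v *)
(* Write f for the density of Qs and h'(f) for its extended derivative.

   Given four points z = (x, y), z' = (x', y'), (x, y') and (x', y), moving a
   little mass from (x, y') and (x', y) to z and z' preserves both marginals.
   Doing so simultaneously for all quadruples of a set K, truncated so that the
   densities of the moved masses with respect to P are bounded, changes the
   objective at first order by the integral over K of
     h'(f z) + h'(f z') - h'(f (x, y')) - h'(f (x', y)),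
   where Fatou's lemma allows the first two terms to be -oo. By optimality K is
   null as soon as this integrand is negative on K.

   If f z = 0 while f (x, y') and f (x', y) are positive the integrand is -oo.
   Since the conditional measures of Qs are nonzero, almost every zero z of f
   would admit a non-null set of such z', so f > 0 almost everywhere.

   Applying the same fact to both orientations of the exchange, the integrand
   vanishes for almost all (z, z'); fixing a typical z gives the potentials. *)
Require Import Defs.
From HB Require Import structures.
From mathcomp Require Import all_boot all_order all_algebra.
From mathcomp Require Import all_classical all_reals all_analysis.
From mathcomp Require Import measurable_realfun.
From mathcomp Require Import ring lra.

Set Implicit Arguments.
Unset Strict Implicit.
Unset Printing Implicit Defensive.
Import Order.TTheory GRing.Theory Num.Theory.
Import numFieldNormedType.Exports.
Local Open Scope ring_scope.
Local Open Scope classical_set_scope.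

(** * Difference quotients of the integrand *)

Section half_line_calculus.
Context (R : realType) (h : R -> R).
Local Notation h' := (derive1 h).
Hypothesis h_cont : {within `[0, +oo[%classic, continuous h}.
Hypothesis h_C2 : C2_pos h.
Hypothesis h'_0 : h' x @[x --> 0^'+] --> -oo%R.

Lemma derive1_continuous_pos x : 0 < x -> {for x, continuous h'}.
Proof.
move=> x0; have [_ dh' _] := h_C2.
apply: differentiable_continuous; apply/derivable1_diffP; apply: dh'.
by rewrite inE /= in_itv /= x0.
Qed.

(** The mean value theorem asks for differentiability only inside the interval, so the left end may
    be 0, where [h] is merely continuous. *)
Lemma mean_value_nneg x y : 0 <= x -> x < y ->
  exists2 c, x < c < y & h y - h x = h' c * (y - x).
Proof.
move=> x0 xy; have [dh _ _] := h_C2.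
have [c cxy ->] : exists2 c, c \in `]x, y[%R & h y - h x = h' c * (y - x).
  apply: MVT => // [c|].
    rewrite in_itv /= => /andP[xc _]; rewrite derive1E; apply/derivableP/dh.
    by rewrite inE /= in_itv /= andbT (le_lt_trans x0).
  apply: continuous_subspaceW h_cont => c /=; rewrite !in_itv /= andbT.
  by move=> /andP[xc _]; exact: le_trans xc.
by exists c => //; move: cxy; rewrite in_itv.
Qed.

(** The mean value theorem on the segment between [x] and [x + e * w], in either order. The
    intermediate point is positive even if one end is 0, so [h' c] is a genuine derivative. *)
Lemma slope_eq_derive1 x w e : 0 <= x -> w != 0 -> 0 < e -> 0 <= x + e * w ->
  exists c, [/\ 0 < c, `|c - x| <= e * `|w| &
                e^-1 * (h (x + e * w) - h x) = h' c * w].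
Proof.
move=> x0 w0 e0 xew; have eN0 : e != 0 by rewrite gt_eqF.
have [w_gt|w_lt|wE] := ltgtP w 0; last by rewrite wE eqxx in w0.
- have xlt : x + e * w < x by rewrite gtrDl nmulr_llt0.
  have [c /andP[xc cx] hE] := mean_value_nneg xew xlt.
  exists c; split.
  + exact: le_lt_trans xc.
  + by rewrite ltr0_norm ?subr_lt0// ltr0_norm// mulrN lerNl opprK lerBrDl ltW.
  + by rewrite -opprB hE -mulrN opprB [x + _]addrC addrK mulrCA mulKf.
- have xlt : x < x + e * w by rewrite ltrDl mulr_gt0.
  have [c /andP[xc cx] hE] := mean_value_nneg x0 xlt.
  exists c; split.
  + exact: le_lt_trans xc.
  + by rewrite gtr0_norm ?subr_gt0// gtr0_norm// lerBlDl ltW.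
  + by rewrite hE [x + _]addrC addrK mulrCA mulKf.
Qed.

(** The upper bound reaches down to 0 because [h'] tends to [-oo] there; for the same reason the
    lower bound must stay away from 0. The remaining range is compact. *)
Lemma derive1_bounds m M : 0 < m -> exists2 C : R, 0 <= C &
  (forall x, 0 < x <= M -> h' x <= C) /\
  (forall x, m <= x <= M -> - C <= h' x).
Proof.
move=> m0.
have [d /= d0 hd] : \forall x \near 0^'+, h' x <= 0.
  by move/cvgrNyPle : h'_0; exact.
(* Below [a] the derivative is nonpositive, and [a <= m] leaves both ranges to a compact interval.
   [Num.max a M] keeps that interval nonempty if [M < a]. *)
pose a := Num.min (d / 2) m.
have a0 : 0 < a by rewrite lt_min m0 divr_gt0.
have aM : a <= Num.max a M by rewrite le_max lexx.
have ch : {within `[a, Num.max a M], continuous h'}.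
  apply: continuous_in_subspaceT => x /set_mem /=; rewrite in_itv /= => /andP[ax _].
  by apply: derive1_continuous_pos; exact: lt_le_trans ax.
have [u _ hu] := EVT_max aM ch.
have [v _ hv] := EVT_min aM ch.
exists (Num.max `|h' u| `|h' v|); first by rewrite le_max normr_ge0.
split=> x /andP[xl xM].
  have [xa|ax] := ltP x a.
    rewrite (@le_trans _ _ 0)// ?le_max ?normr_ge0//; apply: hd => //=.
    rewrite sub0r normrN gtr0_norm// (lt_le_trans xa)// ge_min; apply/orP; left.
    by rewrite ler_pdivrMr// ler_peMr ?ler1n// ltW.
  rewrite le_max (le_trans (hu x _)) ?ler_norm// in_itv /= ax le_max xM orbT//.
have ax : a <= x by rewrite (le_trans _ xl)// ge_min lexx orbT.
rewrite lerNl le_max; apply/orP; right.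
rewrite -normrN (le_trans _ (ler_norm _))// lerN2 hv// in_itv /= ax le_max xM orbT//.
Qed.

Lemma derive_ext0 : derive_ext h 0 = -oo%E.
Proof. by rewrite /derive_ext eqxx; apply/cvg_lim => //; exact/cvgerNyP. Qed.

Lemma derive_ext_pos x : 0 < x -> derive_ext h x = (h' x)%:E.
Proof. by move=> x0; rewrite /derive_ext gt_eqF. Qed.

Lemma derive_ext_lty x : 0 <= x -> (derive_ext h x < +oo)%E.
Proof.
rewrite le_eqVlt => /orP[/eqP <-|x0]; first by rewrite derive_ext0.
by rewrite derive_ext_pos// ltry.
Qed.

Lemma measurable_nneg : measurable_fun (`[0, +oo[%classic : set R) h.
Proof. exact: subspace_continuous_measurable_fun. Qed.

Lemma measurable_derive1_pos :
  measurable_fun (`]0, +oo[%classic : set R) h'.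
Proof.
apply: open_continuous_measurable_fun; first exact: interval_open.
move=> x /set_mem /=; rewrite in_itv /= andbT; exact: derive1_continuous_pos.
Qed.

Lemma measurable_derive_ext :
  measurable_fun (`[0, +oo[%classic : set R) (derive_ext h).
Proof.
rewrite -(setU1itv false)//; apply/measurable_funU => //; split.
  exact: measurable_fun_set1.
apply: (eq_measurable_fun (EFin \o h')).
  by move=> x /set_mem /=; rewrite in_itv /= andbT => x0; rewrite derive_ext_pos.
by apply/measurable_EFinP; exact: measurable_derive1_pos.
Qed.

Lemma measurable_derive_ext_comp d (T : measurableType d) (f : T -> R) :
  measurable_fun setT f -> (forall z, 0 <= f z) ->
  measurable_fun setT (fun z => derive_ext h (f z)).
Proof.
move=> mf f0.
apply: (@measurable_comp _ _ _ _ _ _ (`[0, +oo[%classic : set R)) => //.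
- by move=> _ [z _ <-]; rewrite /= in_itv /= f0.
- exact: measurable_derive_ext.
Qed.

(* The difference quotient is the derivative at an intermediate point, so at
   [x = 0] it inherits the limit [-oo] of the derivative. *)
Lemma cvg_slope_derive_ext x w (e : R^nat) : 0 <= x -> w != 0 ->
  (forall n, 0 < e n) -> (forall n, 0 <= x + e n * w) -> e @ \oo --> 0 ->
  ((e n)^-1 * (h (x + e n * w) - h x))%:E @[n --> \oo] -->
    (derive_ext h x * w%:E)%E.
Proof.
move=> x0 w0 e0 xew e_cvg.
have /choice[c cP] : forall n, exists c, [/\ 0 < c, `|c - x| <= e n * `|w| &
    (e n)^-1 * (h (x + e n * w) - h x) = h' c * w].
  by move=> n; exact: slope_eq_derive1.
have cx : c @ \oo --> x.
  have cx0 : (fun n => c n - x) @ \oo --> 0.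
    have ew : (fun n => e n * `|w|) @ \oo --> 0.
      by rewrite -[X in _ --> X](mul0r `|w|); exact: cvgMl.
    apply/norm_cvg0P; apply: (squeeze_cvgr _ (cvg_cst 0) ew).
    by apply: nearW => n; rewrite normr_ge0 /=; have [] := cP n.
  rewrite -[X in _ --> X]add0r (_ : c = fun n => (c n - x) + x).
    exact: cvgD cx0 (cvg_cst x).
  by apply/funext => n; rewrite subrK.
have -> : (fun n => ((e n)^-1 * (h (x + e n * w) - h x))%:E) =
    (fun n => (h' (c n) * w)%:E).
  by apply/funext => n; have [_ _ ->] := cP n.
move: x0; rewrite le_eqVlt => /orP[/eqP x0|x0].
  (* At [x = 0], nonnegativity of the perturbed point forces [w > 0], so the claimed limit is
     [-oo]. *)
  have w_gt0 : 0 < w.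
    move: (xew 0%N); rewrite -x0 add0r pmulr_rge0// le_eqVlt.
    by rewrite eq_sym (negbTE w0).
  rewrite -x0 derive_ext0 gt0_mulNye ?lte_fin//.
  apply/cvgeNyPle => A.
  have [d /= d0 hd] : \forall x \near 0^'+, h' x <= A / w.
    by move/cvgrNyPle : h'_0; exact.
  near=> n; rewrite lee_fin -ler_pdivlMr//; apply: hd => /=.
    near: n; move/cvgrPdist_lt : cx; rewrite -x0; exact.
  by have [] := cP n.
rewrite derive_ext_pos// -EFinM; apply: cvg_EFin; first exact: nearW.
apply: cvgMl; apply: continuous_cvg => //.
exact: derive1_continuous_pos.
Unshelve. all: by end_near. Qed.

End half_line_calculus.

Local Open Scope ereal_scope.

(** * Densities of images of restricted measures *)

(** The finite integral of [f] cancels, which leaves a function [g - f] that is strictly positive on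
    [D] and has integral zero there. [g] may take the value [+oo]. *)
Lemma null_of_integral_le d (T : measurableType d) (R : realType)
    (mu : {measure set T -> \bar R}) (D : set T) (f g : T -> \bar R) :
  measurable D -> measurable_fun D f -> measurable_fun D g ->
  (forall x, D x -> 0 <= f x) -> (forall x, D x -> f x < g x) ->
  \int[mu]_(x in D) g x <= \int[mu]_(x in D) f x ->
  \int[mu]_(x in D) f x < +oo -> mu D = 0.
Proof.
move=> mD mf mg f0 fg gf foo.
have f_fin x : D x -> f x \is a fin_num.
  by move=> Dx; rewrite ge0_fin_numE ?f0// (lt_le_trans (fg x Dx))// leey.
have mgf : measurable_fun D (fun x => g x - f x) by exact: emeasurable_funB.
have gf0 x : D x -> 0 <= g x - f x.
  by move=> Dx; rewrite sube_ge0 ?f_fin// ltW// fg.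
have : \int[mu]_(x in D) g x =
    \int[mu]_(x in D) f x + \int[mu]_(x in D) (g x - f x).
  rewrite -ge0_integralD//; apply: eq_integral => x /set_mem Dx.
  by rewrite addeC subeK// f_fin.
move=> gE; move: gf; rewrite gE -[leRHS]adde0 leeD2lE; last first.
  by rewrite ge0_fin_numE// integral_ge0.
move=> int0.
have : \int[mu]_(x in D) `|g x - f x| = 0.
  apply/eqP; rewrite eq_le; apply/andP; split; last exact: integral_ge0.
  rewrite (le_trans _ int0)// le_eqVlt; apply/orP; left; apply/eqP.
  by apply: eq_integral => x /set_mem Dx; rewrite gee0_abs// gf0.
move=> /(ae_eq_integral_abs _ mD mgf) [N [mN N0 DN]].
apply: (subset_measure0 mD mN _ N0) => x Dx; apply: DN => /= /(_ Dx)/eqP.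
by rewrite gt_eqF// sube_gt0 fg.
Qed.

Section restricted_image.
Context d d' (Om : measurableType d') (T : measurableType d) (R : realType).
Variables (pi : {finite_measure set Om -> \bar R}) (K : set Om).
Variables (mK : measurable K) (a : {mfun Om >-> T}).

Definition restricted_image : set T -> \bar R := pushforward (mrestr pi mK) a.

Let restricted_image0 : restricted_image set0 = 0.
Proof. by rewrite /restricted_image /pushforward preimage_set0 measure0. Qed.

Let mpre A : measurable A -> measurable (a @^-1` A).
Proof. exact: measurable_funPTI. Qed.

Let restricted_image_ge0 A : 0 <= restricted_image A.
Proof. exact: measure_ge0. Qed.

Let restricted_image_sigma_additive : semi_sigma_additive restricted_image.
Proof.
apply: (@measure_semi_sigma_additive _ _ _
  (pushforward (mrestr pi mK) a : {measure set T -> \bar R})).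
exact: measurable_funPT.
Qed.

HB.instance Definition _ := isMeasure.Build _ _ _ restricted_image
  restricted_image0 restricted_image_ge0 restricted_image_sigma_additive.

Let restricted_image_fin : fin_num_fun restricted_image.
Proof. by move=> A mA; apply: (fin_num_measure (mrestr pi mK)); exact: mpre. Qed.

HB.instance Definition _ := Measure_isFinite.Build _ _ _ restricted_image
  restricted_image_fin.

Lemma integral_restricted_image (F : T -> \bar R) :
  measurable_fun setT F -> (forall z, 0 <= F z) ->
  \int[restricted_image]_z F z = \int[pi]_(w in K) F (a w).
Proof.
move=> mF F0; rewrite ge0_integral_pushforward//.
have mFa : measurable_fun setT (F \o a) by exact: measurableT_comp.
rewrite preimage_setT (ge0_negligible_integral (measurableC mK))//; last 2 first.
  by move=> w _; exact: F0.
  by rewrite /= /mrestr setICl measure0.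
rewrite setTD setCK; apply: eq_measure_integral => A mA AK.
by rewrite /= /mrestr setIidl.
Qed.

End restricted_image.

(** As [a] maps [K] into [S], the image of [pi] restricted to [K] gives [A] at most [N * P (A & S)],
    writing [&] for intersection. It therefore has a density, which is at most [N] and vanishes off
    [S] almost everywhere. *)
Lemma restricted_image_density d d' (Om : measurableType d')
    (T : measurableType d) (R : realType) (pi : probability Om R)
    (P : probability T R) (K : set Om) (a : Om -> T) (S : set T)
    (N : R) :
  measurable K -> measurable_fun setT a -> measurable S -> (0 < N)%R ->
  (forall A, measurable A -> A `<=` S -> pi (a @^-1` A) <= N%:E * P A) ->
  K `<=` a @^-1` S ->
  exists g : T -> R, [/\ measurable_fun setT g,
    (forall z, 0 <= g z <= N)%R, (forall z, ~ S z -> g z = 0%R) &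
    forall F : T -> \bar R, measurable_fun setT F -> (forall z, 0 <= F z) ->
      \int[P]_z (F z * (g z)%:E) = \int[pi]_(w in K) F (a w)].
Proof.
move=> mK ma mS N0.
pose a' : {mfun Om >-> T} := HB.pack a (isMeasurableFun.Build _ _ _ _ _ ma).
rewrite -[a]/(a' : Om -> T); move: a' => {ma} {}a aN KS.
have mpre A : measurable A -> measurable (a @^-1` A) by exact: measurable_funPTI.
pose la : {finite_measure set T -> \bar R} := restricted_image pi mK a.
have laE A : la A = pi (a @^-1` A `&` K) by [].
have laN A : measurable A -> la A <= N%:E * P (A `&` S).
  move=> mA; rewrite laE; apply: (@le_trans _ _ (pi (a @^-1` (A `&` S)))).
    by apply: le_measure; rewrite ?inE; [exact: measurableI (mpre _ mA) mK|
      exact/mpre/measurableI|move=> w [? /KS]].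
  by apply: aN => //; exact: measurableI.
have laP : la `<< P.
  apply/null_content_dominatesP => A mA PA0.
  apply/eqP; rewrite -measure_le0 (le_trans (laN _ mA))//.
  rewrite (_ : P _ = 0) ?mule0//; apply: (subset_measure0 _ mA _ PA0) => //.
  exact: measurableI.
pose g0 := Radon_Nikodym_SigmaFinite.f la P.
have g00 z : 0 <= g0 z by exact: Radon_Nikodym_SigmaFinite.f_ge0.
have g0fin z : g0 z \is a fin_num by exact: Radon_Nikodym_SigmaFinite.f_fin_num.
have mg0 : measurable_fun setT g0.
  exact: measurable_int (Radon_Nikodym_SigmaFinite.f_integrable laP).
have g0E A : measurable A -> la A = \int[P]_(z in A) g0 z.
  exact: Radon_Nikodym_SigmaFinite.f_integral.
have mB : measurable [set z | N%:E < g0 z].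
  by rewrite -[X in measurable X]setTI; exact: emeasurable_fun_o_infty.
have B0 : P [set z | N%:E < g0 z] = 0.
  apply: (@null_of_integral_le _ _ _ _ _ (cst N%:E) g0) => //.
  - exact: measurable_funTS.
  - by move=> z _; rewrite lee_fin ltW.
  - rewrite -g0E// integral_cst// (le_trans (laN _ mB))// lee_pmul2l//.
    by apply: le_measure; rewrite ?inE//; exact: measurableI.
  - rewrite integral_cst// lte_mul_pinfty// ?lee_fin ?ltW//.
    by rewrite -ge0_fin_numE ?fin_num_measure.
(* The image measure of this set is at most [N] times the measure of its part inside [S], which is
   empty. *)
have C0 : P ([set z | 0 < g0 z] `&` ~` S) = 0.
  have mC : measurable ([set z | 0 < g0 z] `&` ~` S).
    apply: measurableI; last exact: measurableC.
    by rewrite -[X in measurable X]setTI; exact: emeasurable_fun_o_infty.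
  apply: (@null_of_integral_le _ _ _ _ _ (cst 0) g0) => //.
  - exact: measurable_funTS.
  - by move=> z [].
  - rewrite -g0E// integral_cst// mul0e (le_trans (laN _ mC))//.
    by rewrite -setIA setICl setI0 measure0 mule0.
  - by rewrite integral_cst// mul0e.
(* Truncation and indicator turn the almost everywhere bounds into bounds everywhere; [g0] changes
   only on the two null sets just found. *)
pose g z := (Num.min (fine (g0 z)) N * \1_S z)%R.
have gN z : (0 <= g z <= N)%R.
  rewrite /g indicE; case: (z \in S); rewrite ?mulr0 ?mulr1 ?lexx ?(ltW N0)//.
  by rewrite ge_min lexx orbT andbT le_min fine_ge0// ltW.
have mg : measurable_fun setT g.
  apply: measurable_funM => //; apply: measurable_minr => //.
  exact: measurableT_comp.
exists g; split=> //.
  by move=> z Sz; rewrite /g indicE memNset ?mulr0.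
move=> F mF F0.
rewrite -(@integral_restricted_image _ _ _ _ _ pi K mK a)//.
rewrite -[RHS](Radon_Nikodym_SigmaFinite.change_of_variables laP)//.
apply: ge0_ae_eq_integral => //.
- by apply: emeasurable_funM => //; exact/measurable_EFinP.
- exact: emeasurable_funM.
- by move=> z _; rewrite mule_ge0// lee_fin; have /andP[] := gN z.
- by move=> z _; rewrite mule_ge0.
have mC : measurable ([set z | 0 < g0 z] `&` ~` S).
  apply: measurableI; last exact: measurableC.
  by rewrite -[X in measurable X]setTI; exact: emeasurable_fun_o_infty.
exists ([set z | N%:E < g0 z] `|` ([set z | 0 < g0 z] `&` ~` S)); split.
- exact: measurableU.
- exact: null_set_setU.
- move=> z /=; apply: contra_notP => /not_orP[/negP NB NC] _.
  congr (_ * _); rewrite /g indicE; have [Sz|Sz] := pselect (S z).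
    rewrite mem_set// mulr1 min_l ?fineK//.
    by rewrite -lee_fin fineK// leNgt; exact: NB.
  rewrite memNset// mulr0; apply/esym/eqP; rewrite eq_le g00 andbT leNgt.
  by apply/negP => gz; apply: NC.
Qed.

(** * Perturbed couplings *)

Section with_density.
Context d (T : measurableType d) (R : realType).
Variables (P : {measure set T -> \bar R}) (g : T -> R).
Hypotheses (mg : measurable_fun setT g) (g0 : forall z, (0 <= g z)%R).
Hypothesis g1 : \int[P]_z (g z)%:E = 1.

Definition with_density (A : set T) : \bar R := \int[P]_(z in A) (g z)%:E.

Let with_density0 : with_density set0 = 0.
Proof. by rewrite /with_density integral_set0. Qed.

Let with_density_ge0 A : 0 <= with_density A.
Proof. by apply: integral_ge0 => z _; rewrite lee_fin. Qed.

Let with_density_sigma_additive : semi_sigma_additive with_density.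
Proof.
move=> F mF tF mUF; rewrite /with_density ge0_integral_bigcup//; last 2 first.
- by apply/measurable_EFinP; exact: measurable_funTS.
- by move=> z _; rewrite lee_fin.
apply: is_cvg_ereal_nneg_natsum_cond => n _ _.
by apply: integral_ge0 => z _; rewrite lee_fin.
Qed.

HB.instance Definition _ := isMeasure.Build _ _ _ with_density
  with_density0 with_density_ge0 with_density_sigma_additive.

HB.instance Definition _ := Measure_isProbability.Build _ _ _ with_density g1.

Lemma exists_probability_with_density : exists Q : probability T R,
  forall A, Q A = \int[P]_(z in A) (g z)%:E.
Proof. by exists with_density. Qed.

End with_density.

Section coupling_perturbation.
Context (R : realType) (X Y : ptopologicalType).
Implicit Types P Q : probability (borel X * borel Y)%type R.

Lemma density_measurable P Q : Q `<< P ->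
  measurable_fun setT (density Q P : borel X * borel Y -> R).
Proof.
move=> QP; apply: measurableT_comp => //.
exact: measurable_int (Radon_Nikodym_SigmaFinite.f_integrable QP).
Qed.

Lemma measurable_density_gt0 P Q : Q `<< P ->
  measurable [set z : borel X * borel Y | (0 < density Q P z)%R].
Proof.
move=> QP; rewrite -[X in measurable X]setTI.
apply: (@emeasurable_fun_o_infty _ _ _ _
  (fun z : borel X * borel Y => (density Q P z)%:E) _ _ 0) => //.
by apply/measurable_EFinP; exact: density_measurable.
Qed.

(** [density] is one chosen version of the derivative, so an explicit density agrees with it only
    almost everywhere: both have the same integral over every measurable set. *)
Lemma density_ae_eq P Q (g : borel X * borel Y -> R) :
  measurable_fun setT g ->
  (forall A, measurable A -> Q A = \int[P]_(z in A) (g z)%:E) ->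
  Q `<< P /\ ae_eq P setT (density Q P : borel X * borel Y -> R) g.
Proof.
move=> mg QE; have QP : Q `<< P.
  apply/null_content_dominatesP => A mA PA0; rewrite QE//.
  apply: null_set_integral => //; apply/measurable_EFinP.
  exact: measurable_funTS.
split=> //.
have : ae_eq P setT (EFin \o (density Q P : borel X * borel Y -> R)) (EFin \o g).
  apply: integral_ae_eq => //.
  - rewrite (_ : _ \o _ = Radon_Nikodym_SigmaFinite.f Q P).
      exact: Radon_Nikodym_SigmaFinite.f_integrable.
    apply/funext => z; rewrite /= /density fineK//.
    exact: Radon_Nikodym_SigmaFinite.f_fin_num.
  - exact/measurable_EFinP.
  - by move=> E _ mE; rewrite -QE// -density_integral.
by apply: filterS => z /= /[apply] -[].
Qed.

(** Since [wp] and [wm] have equal marginals, the perturbed function is the density of another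
    coupling, which competes with the optimizer. *)
Lemma optimizer_perturbation (mu : probability (borel X) R)
    (nu : probability (borel Y) R) P Qs (h : R -> R)
    (wp wm : borel X * borel Y -> R) (N : R) :
  optimizer h P mu nu Qs -> Qs `<< P ->
  measurable_fun (`[0%R, +oo[%classic : set R) h ->
  measurable_fun setT wp -> measurable_fun setT wm ->
  (forall z, 0 <= wp z <= N)%R -> (forall z, 0 <= wm z <= N)%R ->
  (forall z, 0 <= density Qs P z + (wp z - wm z))%R ->
  (forall A, measurable A -> \int[P]_(z in A `*` setT) (wp z)%:E =
                             \int[P]_(z in A `*` setT) (wm z)%:E) ->
  (forall B, measurable B -> \int[P]_(z in setT `*` B) (wp z)%:E =
                             \int[P]_(z in setT `*` B) (wm z)%:E) ->
  \int[P]_z (h (density Qs P z))%:E <=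
  \int[P]_z (h (density Qs P z + (wp z - wm z)))%:E.
Proof.
move=> [[QsX QsY] Qopt] QsP mh mwp mwm wpN wmN f0 wX wY.
pose f : borel X * borel Y -> R := density Qs P.
have mf : measurable_fun setT f := density_measurable QsP.
have wp0 z : (0 <= wp z)%R by case/andP: (wpN z).
have wm0 z : (0 <= wm z)%R by case/andP: (wmN z).
pose g z := (f z + (wp z - wm z))%R.
have mg : measurable_fun setT g.
  by apply: measurable_funD => //; exact: measurable_funB.
have key A : measurable A ->
    \int[P]_(z in A) (wp z)%:E = \int[P]_(z in A) (wm z)%:E ->
    \int[P]_(z in A) (g z)%:E = Qs A.
  move=> mA wE; rewrite (density_integral QsP)//.
  have wmfin : \int[P]_(z in A) (wm z)%:E \is a fin_num.
    rewrite ge0_fin_numE; last by apply: integral_ge0 => z _; rewrite lee_fin.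
    apply: (@le_lt_trans _ _ (\int[P]_(z in A) (cst N%:E z))).
      apply: ge0_le_integral => //=.
      + by move=> z _; rewrite lee_fin.
      + by apply/measurable_EFinP; exact: measurable_funTS.
      + by move=> z _; rewrite lee_fin; case/andP: (wmN z).
    by rewrite integral_cst// ltey_eq fin_numM// fin_num_measure.
  (* With [wm] on the other side all integrands are nonnegative; the bound [N] makes its integral
     finite, so it can be subtracted again. *)
  have : \int[P]_(z in A) (g z)%:E + \int[P]_(z in A) (wm z)%:E =
      \int[P]_(z in A) (f z)%:E + \int[P]_(z in A) (wp z)%:E.
    rewrite -!ge0_integralD//; try by [apply/measurable_EFinP;
      exact: measurable_funTS|move=> z _; rewrite lee_fin//; exact: f0|
      move=> z _; rewrite lee_fin; exact: density_ge0].
    by apply: eq_integral => z _; rewrite /g -!EFinD addrA subrK.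
  rewrite wE => /(congr1 (fun t => t - \int[P]_(z in A) (wm z)%:E)).
  by rewrite !addeK.
have XX : [set: borel X * borel Y] = setT `*` setT by rewrite setXTT.
have [Q QE] : exists Q : probability (borel X * borel Y)%type R,
    forall A, Q A = \int[P]_(z in A) (g z)%:E.
  apply: exists_probability_with_density => //.
  by rewrite key// ?probability_setT// XX; exact: wX.
have [QP fg] : Q `<< P /\ ae_eq P setT (density Q P : borel X * borel Y -> R) g.
  by apply: density_ae_eq.
have Qcpl : cpl mu nu Q.
  split=> A mA; rewrite /pushforward QE.
    have -> : fst @^-1` A = A `*` [set: Y].
      by apply/seteqP; split=> z //= [].
    rewrite key; last exact: wX.
      by rewrite -QsX// /pushforward; congr (Qs _); apply/seteqP; split=> z //= [].
    exact: measurableX.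
  have -> : snd @^-1` A = [set: X] `*` A.
    by apply/seteqP; split=> z //= [].
  rewrite key; last exact: wY.
    by rewrite -QsY// /pushforward; congr (Qs _); apply/seteqP; split=> z //= [].
  exact: measurableX.
have : objective h P Qs <= objective h P Q.
  by rewrite Qopt; apply: ereal_inf_lbound; exists Q.
rewrite /objective asboolT// asboolT// => /le_trans; apply.
have mhc (k : borel X * borel Y -> R) : measurable_fun setT k ->
    (forall z, 0 <= k z)%R -> measurable_fun setT (fun z => (h (k z))%:E).
  move=> mk k0; apply/measurable_EFinP.
  apply: (@measurable_comp _ _ _ _ _ _ (`[0%R, +oo[%classic : set R)) => //.
  by move=> _ [z _ <-]; rewrite /= in_itv /= k0.
(* The objective of [Q] is computed with its chosen density, which is only almost everywhere equal
   to [g]. *)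
rewrite le_eqVlt; apply/orP; left; apply/eqP; apply: ae_eq_integral => //.
- by apply: mhc; [exact: density_measurable|move=> z; exact: density_ge0].
- exact: mhc.
- by apply: filterS fg => z /= /[apply] ->.
Qed.

End coupling_perturbation.

(** * First-order condition *)

(** Given a finite positive part, an infinite negative part would force the integral to be [-oo]. *)
Lemma integrable_of_integral_gtNy d (T : measurableType d) (R : realType)
    (mu : {measure set T -> \bar R}) (u : T -> \bar R) :
  measurable_fun setT u -> \int[mu]_z u^\+ z < +oo -> -oo < \int[mu]_z u z ->
  mu.-integrable setT u.
Proof.
move=> mfu up um; apply/integrableP; split=> //.
rewrite -[fun z => _]/(abse \o u) fune_abse.
rewrite ge0_integralD//; last 2 first.
- exact: measurable_funepos.
- exact: measurable_funeneg.
rewrite lte_add_pinfty//; move: um; rewrite integralE.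
case: (\int[mu]_z u^\- z) => [x _|/=|//]; first exact: ltry.
by rewrite addeNy ltxx.
Qed.

(** By the convention [+oo - +oo = -oo], the integral is infinite as soon as one of the two parts
    has an infinite integral. *)
Lemma integrable_of_integral_fin_num d (T : measurableType d) (R : realType)
    (mu : {measure set T -> \bar R}) (u : T -> \bar R) :
  measurable_fun setT u -> \int[mu]_z u z \is a fin_num ->
  mu.-integrable setT u.
Proof.
move=> mfu ufin; apply: integrable_of_integral_gtNy => //; last first.
  by move: ufin; rewrite fin_numElt => /andP[].
move: ufin; rewrite integralE.
case: (\int[mu]_z u^\+ z) => [x _|/=|//]; first exact: ltry.
by case: (\int[mu]_z u^\- z).
Qed.

Lemma limn_einf_le_cst (R : realType) (u : (\bar R)^nat) (l : \bar R) :
  (forall n, u n <= l) -> limn_einf u <= l.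
Proof.
move=> ul; rewrite limn_einf_lim; apply: lime_le; first exact: is_cvg_einfs.
by apply: nearW => n; apply: le_trans (ul n); apply: ereal_inf_lbound; exists n => /=.
Qed.

Section first_order_condition.
Context d (T : measurableType d) (R : realType) (P : probability T R).
Variable h : R -> R.
Hypothesis h_cont : {within `[0%R, +oo[%classic, continuous h}.
Hypothesis h_C2 : C2_pos h.
Hypothesis h'_0 : derive1 h x @[x --> 0%R^'+] --> -oo%R.
Variables (f wp wm : T -> R) (m M C N : R).
Hypotheses (m0 : (0 < m)%R) (C0 : (0 <= C)%R) (N0 : (0 <= N)%R).
Hypothesis CM : forall x, (0 < x <= M + 1)%R -> (derive1 h x <= C)%R.
Hypothesis Cm : forall x, (m / 2 <= x <= M + 1)%R -> (- C <= derive1 h x)%R.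
Hypotheses (mf : measurable_fun setT f) (f0 : forall z, (0 <= f z)%R).
Hypotheses (mwp : measurable_fun setT wp) (mwm : measurable_fun setT wm).
Hypothesis wpN : forall z, (0 <= wp z <= N)%R.
Hypothesis wmN : forall z, (0 <= wm z <= N)%R.
Hypothesis wpM : forall z, wp z != 0%R -> (f z <= M)%R.
Hypothesis wmM : forall z, wm z != 0%R -> (m <= f z <= M)%R.
Hypothesis w_mass : \int[P]_z (wp z)%:E = \int[P]_z (wm z)%:E.
Hypothesis hf_fin : \int[P]_z (h (f z))%:E \is a fin_num.
Hypothesis f_opt : forall e : R, (0 < e)%R ->
  (forall z, 0 <= f z + e * (wp z - wm z))%R ->
  \int[P]_z (h (f z))%:E <= \int[P]_z (h (f z + e * (wp z - wm z)))%:E.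

Let w z := (wp z - wm z)%R.

Let wp0 z : (0 <= wp z)%R. Proof. by case/andP: (wpN z). Qed.
Let wm0 z : (0 <= wm z)%R. Proof. by case/andP: (wmN z). Qed.

Let wN z : (`|w z| <= N)%R.
Proof.
rewrite ler_norml /w; apply/andP; split.
  by rewrite lerBrDl (le_trans _ (wp0 z))// subr_le0; case/andP: (wmN z).
by rewrite lerBlDr (le_trans (andP (wpN z)).2)// lerDl.
Qed.

Let mw : measurable_fun setT w. Proof. exact: measurable_funB. Qed.

(** Where [wp] or [wm] is nonzero, [f <= M] gives [h' (f) <= C], so the truncation at 0 has no
    effect there. Nonnegativity gives all integrals a meaning, with [gain = +oo] where [f]
    vanishes. *)
Let gain z : \bar R := maxe 0 (C%:E - derive_ext h (f z)).

(* The bounds on the derivative make [r e] nonnegative for small [e], which is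
   what Fatou's lemma needs; its limit as [e] tends to 0 is
   [C * (wp + wm) - h' (f) * (wp - wm)], read as [+oo] where [f] vanishes and
   [wp] does not. *)
Let r e z := (C * (wp z + wm z) - e^-1 * (h (f z + e * w z) - h (f z)))%R.

(** For such [e], a point with [f >= m] stays above [m / 2] and one with [f <= M] stays below
    [M + 1], inside the ranges of [Cm] and [CM]. *)
Let small e := (0 < e)%R /\ (e * N <= m / 2)%R /\ (e * N <= 1)%R.

Let w_pos z : (0 < w z)%R -> (f z <= M)%R.
Proof.
rewrite subr_gt0 => wz; apply: wpM; rewrite gt_eqF//.
exact: le_lt_trans wz.
Qed.

Let w_neg z : (w z < 0)%R -> (m <= f z <= M)%R.
Proof.
rewrite subr_lt0 => wz; apply: wmM; rewrite gt_eqF//.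
exact: le_lt_trans wz.
Qed.

Let perturbed_ge0 e z : small e -> (0 <= f z + e * w z)%R.
Proof.
move=> [e0 [em _]]; have [w_ge|w_lt] := leP 0%R (w z).
  by rewrite addr_ge0// mulr_ge0// ltW.
have /andP[mfz _] := w_neg w_lt.
rewrite -lerBlDr sub0r -mulrN (le_trans _ mfz)//.
rewrite (@le_trans _ _ (e * N)%R)//.
  by rewrite ler_pM2l// (le_trans _ (wN z))// -normrN ler_norm.
by rewrite (le_trans em)// ler_pdivrMr// ler_peMr ?ler1n// ltW.
Qed.

(** The difference quotient is [h' c * w] with [c] within [e * N] of [f z]. Where [w > 0], the upper
    bound on [h'] and [w <= wp] suffice; where [w < 0], the lower bound and [- w <= wm]. *)
Let r_ge0 e z : small e -> (0 <= r e z)%R.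
Proof.
move=> se; have [e0 [em e1]] := se; rewrite subr_ge0.
have [wE|w_neq] := eqVneq (w z) 0%R.
  by rewrite wE mulr0 addr0 subrr mulr0 mulr_ge0// addr_ge0.
have [c [c0 cf ->]] :=
  slope_eq_derive1 h_cont h_C2 (f0 z) w_neq e0 (perturbed_ge0 z se).
have {}cf : (`|c - f z| <= e * N)%R by rewrite (le_trans cf)// ler_pM2l.
have [w_lt|w_gt|wE] := ltgtP (w z) 0%R; last by rewrite wE eqxx in w_neq.
- have /andP[mfz fM] := w_neg w_lt.
  rewrite -mulrNN (@le_trans _ _ (C * - w z)%R)//.
    rewrite ler_pM2r ?oppr_gt0// lerNl Cm//; move: cf; rewrite ler_norml.
    by move=> /andP[]; lra.
  by rewrite ler_wpM2l// /w; have := wp0 z; lra.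
- have fM := w_pos w_gt.
  rewrite (@le_trans _ _ (C * w z)%R)//.
    rewrite ler_pM2r// CM// c0 /=; move: cf; rewrite ler_norml.
    by move=> /andP[]; lra.
  by rewrite ler_wpM2l// /w; have := wm0 z; lra.
Qed.

Let mhc (k : T -> R) : measurable_fun setT k -> (forall z, 0 <= k z)%R ->
  measurable_fun setT (fun z => h (k z)).
Proof.
move=> mk k0; apply: (@measurable_comp _ _ _ _ _ _ (`[0%R, +oo[%classic : set R)) => //.
- by move=> _ [z _ <-]; rewrite /= in_itv /= k0.
- exact: measurable_nneg.
Qed.

Let mr e : small e -> measurable_fun setT (r e).
Proof.
move=> se; apply: measurable_funB.
  by apply: measurable_funM => //; exact: measurable_funD.
apply: measurable_funM => //; apply: measurable_funB; apply: mhc => //.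
  by apply: measurable_funD => //; exact: measurable_funM.
by move=> z; exact: perturbed_ge0.
Qed.

Let mgain : measurable_fun setT gain.
Proof.
apply: measurable_maxe => //; apply: emeasurable_funB => //.
exact: measurable_derive_ext_comp.
Qed.

Let gain_ge0 z : 0 <= gain z. Proof. by rewrite /gain le_max lexx. Qed.

Let I := \int[P]_z (wm z)%:E.

Let integrable_bounded (k : T -> R) : measurable_fun setT k ->
  (forall z, 0 <= k z <= N)%R -> P.-integrable setT (EFin \o k).
Proof.
move=> mk kN; apply: measurable_bounded_integrable => //.
  by rewrite ltey_eq fin_num_measure.
exists N; split; first exact: num_real.
move=> x Nx z _ /=; have /andP[k0 kz] := kN z.
by rewrite ger0_norm// (le_trans kz)// ltW.
Qed.

Let I_fin : I \is a fin_num.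
Proof. by apply: integrable_fin_num => //; exact: integrable_bounded. Qed.

(** The integral of [r e] is [C * (I + I)], by equality of the masses, minus [e^-1] times the
    increase of the objective, which is nonnegative by optimality. *)
Let integral_r e : small e -> \int[P]_z (r e z)%:E <= C%:E * (I + I).
Proof.
move=> se; have [e0 _] := se; have eN0 : e != 0%R by rewrite gt_eqF.
pose u z := h (f z + e * w z).
pose k z := (h (f z) + e * C * (wp z + wm z))%R.
have mu : measurable_fun setT u.
  apply: mhc; last by move=> z; exact: perturbed_ge0.
  by apply: measurable_funD => //; exact: measurable_funM.
have iw : P.-integrable setT (fun z => (e * C)%:E * ((wp z)%:E + (wm z)%:E)).
  by apply/integrableZl => //; apply: integrableD => //; exact: integrable_bounded.
have ihf : P.-integrable setT (EFin \o (fun z => h (f z))).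
  by apply: integrable_of_integral_fin_num => //; apply/measurable_EFinP; exact: mhc.
have ik : P.-integrable setT (EFin \o k).
  rewrite (_ : EFin \o k = (EFin \o (fun z => h (f z))) \+
      (fun z => (e * C)%:E * ((wp z)%:E + (wm z)%:E))).
    exact: integrableD.
  by apply/funext => z; rewrite /k /= -!(EFinD, EFinM).
have uk z : (u z <= k z)%R.
  have := r_ge0 z se; rewrite /r -/(u z) subr_ge0 ler_pdivrMl// /k => uz.
  by rewrite -lerBlDl (le_trans uz)// mulrA.
(* [u] lies below the integrable [k] because [r e] is nonnegative, and optimality keeps its integral
   above [-oo]. *)
have iu : P.-integrable setT (EFin \o u).
  apply: integrable_of_integral_gtNy; first exact/measurable_EFinP.
    have /integrableP[_] := integrable_funepos measurableT ik.
    apply: le_lt_trans; apply: ge0_le_integral => //.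
    - by apply: measurable_funepos; exact/measurable_EFinP.
    - apply: measurableT_comp => //; apply: measurable_funepos.
      exact: measurable_int ik.
    - move=> z _; rewrite gee0_abs// !funeposE /= ge_max !le_max lee_fin uk /=.
      by rewrite lexx orbT.
  rewrite (lt_le_trans _ (f_opt e0 _))//; last by move=> z; exact: perturbed_ge0.
  by move: hf_fin; rewrite fin_numElt => /andP[].
have kE : \int[P]_z (k z)%:E = \int[P]_z (h (f z))%:E + (e * C)%:E * (I + I).
  rewrite /k; under eq_integral do rewrite EFinD EFinM EFinD.
  rewrite integralD// integralZl//; last by apply: integrableD => //; exact: integrable_bounded.
  by rewrite integralD//; [rewrite w_mass|exact: integrable_bounded..].
have -> : \int[P]_z (r e z)%:E = \int[P]_z (e^-1%:E * ((k z)%:E - (u z)%:E)).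
  apply: eq_integral => z _; rewrite -EFinB -EFinM /r -/(u z) /k; congr EFin.
  by field.
rewrite integralZl//; last exact: integrableB.
rewrite integralB_EFin// kE.
have hfu : \int[P]_z (h (f z))%:E <= \int[P]_z (u z)%:E.
  by apply: f_opt => // z; exact: perturbed_ge0.
have ufin : \int[P]_z (u z)%:E \is a fin_num by exact: integrable_fin_num.
rewrite -(fineK I_fin) -(fineK hf_fin) -(fineK ufin) in hfu *.
rewrite -!(EFinD, EFinM, EFinN) lee_fin ler_pdivrMl//.
by move: hfu; rewrite lee_fin; lra.
Qed.

(** The minimum meets both smallness conditions after division by a bound on [N]; [N + 1] avoids
    dividing by 0. *)
Let e_ (n : nat) : R := (Num.min (m / 2) 1 / (N + 1) / n.+1%:R)%R.

Let small_e n : small (e_ n).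
Proof.
have mn : (0 < Num.min (m / 2) 1)%R by rewrite lt_min ltr01 andbT divr_gt0.
have N1 : (0 < N + 1)%R by rewrite ltr_wpDl.
have eN : (e_ n * N <= Num.min (m / 2) 1)%R.
  have -> : (e_ n * N = Num.min (m / 2) 1 * (N / ((N + 1) * n.+1%:R)))%R.
    by rewrite /e_; field; rewrite !gt_eqF.
  rewrite ler_piMr ?(ltW mn)// ler_pdivrMr ?mulr_gt0// mul1r.
  by rewrite (@le_trans _ _ (N + 1)%R) ?lerDl// ler_peMr ?ler1n// ltW.
split; first by rewrite !divr_gt0.
by split; rewrite (le_trans eN)// ge_min lexx ?orbT.
Qed.

(** With [gain = C - h' (f)], both sides agree by algebra where mass moves and [f > 0]. Where
    [f = 0] and [wp > 0], the right-hand side is [+oo]. The terms are arranged so that nothing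
    infinite is subtracted. *)
Let pointwise z : gain z * (wp z)%:E + (2 * C)%:E * (wm z)%:E <=
  limn_einf (fun n => (r (e_ n) z)%:E) + gain z * (wm z)%:E.
Proof.
have e_cvg : e_ @ \oo --> (0 : R)%R.
  rewrite -[X in _ --> X](mulr0 (Num.min (m / 2) 1 / (N + 1))%R).
  by apply: cvgMr; exact: cvg_harmonic.
have limE : limn_einf (fun n => (r (e_ n) z)%:E) =
    (C * (wp z + wm z))%:E - derive_ext h (f z) * (w z)%:E.
  apply: (cvg_limn_einf_sup _).1.
  have [wE|w_neq] := eqVneq (w z) 0%R.
    rewrite wE mule0 sube0 /r wE; under eq_fun do rewrite mulr0 addr0 subrr mulr0 subr0.
    exact: cvg_cst.
  under eq_fun do rewrite /r EFinB.
  apply: cvgeB; [exact: fin_num_adde_defr|exact: cvg_cst|].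
  apply: cvg_slope_derive_ext => //.
  - by move=> n; have [] := small_e n.
  - by move=> n; exact: perturbed_ge0.
rewrite limE.
have [wp_eq|wp_neq] := eqVneq (wp z) 0%R; have [wm_eq|wm_neq] := eqVneq (wm z) 0%R.
- rewrite /w wp_eq wm_eq !(mulr0,addr0,subrr) !mule0 !adde0 ?sube0.
  exact: lexx.
- have /andP[mfz fM] := wmM wm_neq.
  have fz0 : (0 < f z)%R by exact: lt_le_trans mfz.
  rewrite /gain derive_ext_pos// max_r; last first.
    by rewrite -EFinB lee_fin subr_ge0 CM// fz0; lra.
  rewrite -!(EFinB, EFinM, EFinD) lee_fin /w; lra.
- have fM := wpM wp_neq.
  have := f0 z; rewrite le_eqVlt => /orP[/eqP fz0|fz0].
    rewrite wm_eq mule0 mule0 !adde0 -fz0 derive_ext0//.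
    rewrite gt0_mulNye ?leey// lte_fin /w wm_eq subr0 lt_neqAle eq_sym wp_neq.
    exact: wp0.
  rewrite /gain derive_ext_pos// max_r; last first.
    by rewrite -EFinB lee_fin subr_ge0 CM// fz0; lra.
  rewrite -!(EFinB, EFinM, EFinD) lee_fin /w; lra.
- have /andP[mfz fM] := wmM wm_neq.
  have fz0 : (0 < f z)%R by exact: lt_le_trans mfz.
  rewrite /gain derive_ext_pos// max_r; last first.
    by rewrite -EFinB lee_fin subr_ge0 CM// fz0; lra.
  rewrite -!(EFinB, EFinM, EFinD) lee_fin /w; lra.
Qed.

(** This expresses that the integral of [h' (f) * (wp - wm)] is nonnegative, without subtracting
    infinite integrals. Fatou's lemma and [integral_r] bound the integral of the lower limit by
    [2 * C * I], and the same finite term cancels on the left of the integrated [pointwise]. *)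
Lemma first_order_condition :
  \int[P]_z (gain z * (wp z)%:E) <= \int[P]_z (gain z * (wm z)%:E).
Proof.
have mgw (k : T -> R) : measurable_fun setT k ->
    measurable_fun setT (fun z => gain z * (k z)%:E).
  by move=> mk; apply: emeasurable_funM => //; exact/measurable_EFinP.
have gw0 (k : T -> R) z : (0 <= k z)%R -> 0 <= gain z * (k z)%:E.
  by move=> k0; rewrite mule_ge0// lee_fin.
set L := fun z => limn_einf (fun n => (r (e_ n) z)%:E).
have mL : measurable_fun setT L.
  apply: (measurableT_comp (@oppe_measurable R setT)).
  apply: measurable_fun_limn_esup => n /=.
  by apply/measurable_EFinP/measurable_funN; exact: mr (small_e n).
have L0 z : 0 <= L z.
  rewrite /L limn_einf_lim; apply: lime_ge; first exact: is_cvg_einfs.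
  apply: nearW => n; apply: le_ereal_inf_tmp => _ [k /= _ <-].
  by rewrite lee_fin (r_ge0 _ (small_e _)).
have IL : \int[P]_z L z <= C%:E * (I + I).
  apply: (le_trans (@fatou _ _ _ P setT measurableT
    (fun n z => (r (e_ n) z)%:E) _ _)).
  - by move=> n; apply/measurable_EFinP; exact: mr (small_e n).
  - by move=> n z _; rewrite lee_fin (r_ge0 _ (small_e _)).
  - by apply: limn_einf_le_cst => n; exact: integral_r (small_e n).
have : \int[P]_z (gain z * (wp z)%:E + (2 * C)%:E * (wm z)%:E) <=
    \int[P]_z (L z + gain z * (wm z)%:E).
  apply: ge0_le_integral => //.
  - by move=> z _; rewrite adde_ge0 ?gw0// mule_ge0// lee_fin// mulr_ge0.
  - by apply: emeasurable_funD; [exact: mgw|apply/measurable_EFinP/measurable_funM].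
  - by apply: emeasurable_funD => //; exact: mgw.
rewrite ge0_integralD//; last 4 first.
- by move=> z _; exact: gw0.
- exact: mgw.
- by move=> z _; rewrite mule_ge0// lee_fin// mulr_ge0.
- by apply/measurable_EFinP/measurable_funM.
rewrite ge0_integralZl//; last 3 first.
- exact/measurable_EFinP.
- by move=> z _; rewrite lee_fin.
- by rewrite lee_fin mulr_ge0.
rewrite ge0_integralD//; last 2 first.
- by move=> z _; exact: gw0.
- exact: mgw.
rewrite -/I => le1.
have : \int[P]_z (gain z * (wp z)%:E) + (2 * C)%:E * I <=
    C%:E * (I + I) + \int[P]_z (gain z * (wm z)%:E).
  by apply: (le_trans le1); exact: leeD2r.
rewrite [leRHS]addeC -(fineK I_fin) -!(EFinM, EFinD).
rewrite (_ : C * (fine I + fine I) = 2 * C * fine I)%R; last by ring.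
by rewrite leeD2rE.
Qed.

End first_order_condition.

(** * Exchanging mass between four points *)

(** If [x1] or [x2] is [-oo], the right-hand side is [+oo]. *)
Lemma lte_sub_sum (R : realDomainType) (C k1 k2 : R) (x1 x2 : \bar R) :
  x1 < +oo -> x2 < +oo -> x1 + x2 < k1%:E + k2%:E ->
  (C%:E - k1%:E) + (C%:E - k2%:E) < (C%:E - x1) + (C%:E - x2).
Proof.
case: x1 => [x1| |]; case: x2 => [x2| |] // _ _;
  try by rewrite /= -!EFinD ?addey// ?addye// ltry.
by rewrite -!(EFinB, EFinD) !lte_fin => ?; lra.
Qed.

Section exchange.
Context (R : realType) (X Y : ptopologicalType).
Context (mu : probability (borel X) R) (nu : probability (borel Y) R).
Variable P : probability (borel X * borel Y)%type R.
Hypothesis prod_P : (mu \x nu) `<< P.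
Variable h : R -> R.
Hypothesis h_cont : {within `[0%R, +oo[%classic, continuous h}.
Hypothesis h_C2 : C2_pos h.
Hypothesis h'_0 : derive1 h x @[x --> 0%R^'+] --> -oo%R.
Variable Qs : probability (borel X * borel Y)%type R.
Hypothesis QsP : Qs `<< P.
Hypothesis Qs_opt : optimizer h P mu nu Qs.
Hypothesis hf_fin : \int[P]_z (h (density Qs P z))%:E \is a fin_num.

Local Notation Z := (borel X * borel Y)%type.
Let prob_prod : probability Z R := mu \x nu.
Let f : Z -> R := density Qs P.

Let mf : measurable_fun setT f. Proof. exact: density_measurable. Qed.
Let f0 z : (0 <= f z)%R. Proof. exact: density_ge0. Qed.

Let H (z : Z) : \bar R := derive_ext h (f z).

Let mH : measurable_fun setT H.
Proof. exact: measurable_derive_ext_comp. Qed.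

Let r : Z -> \bar R := Radon_Nikodym_SigmaFinite.f prob_prod P.

Let mr : measurable_fun setT r.
Proof.
apply: (@measurable_int _ _ _ P).
exact: (Radon_Nikodym_SigmaFinite.f_integrable (nu := prob_prod) prod_P).
Qed.

Context d (Om : measurableType d) (pi : probability Om R).

(** The corners of an exchange are abstract maps with law [mu \x nu], so that interchanging [a1],
    [a2] with [b1], [b2] yields the opposite exchange. *)
Definition image_prod (a : Om -> Z) := measurable_fun setT a /\
  forall A : set Z, measurable A -> pi (a @^-1` A) = (mu \x nu) A.

Variables a1 a2 b1 b2 : Om -> Z.
Hypotheses (a1P : image_prod a1) (a2P : image_prod a2).
Hypotheses (b1P : image_prod b1) (b2P : image_prod b2).
Hypothesis (X1 : forall w, (a1 w).1 = (b1 w).1).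
Hypothesis (X2 : forall w, (a2 w).1 = (b2 w).1).
Hypothesis (Y1 : forall w, (a1 w).2 = (b2 w).2).
Hypothesis (Y2 : forall w, (a2 w).2 = (b1 w).2).

(** The law of [a] has density [r] with respect to [P], so [r <= N] on [S] bounds it by [N * P] on
    subsets of [S]. *)
Let image_density (K : set Om) (a : Om -> Z) (S : set Z) (N : R) :
  measurable K -> image_prod a -> measurable S -> (0 < N)%R ->
  (forall z, S z -> r z <= N%:E) -> (forall w, K w -> S (a w)) ->
  exists g : Z -> R, [/\ measurable_fun setT g,
    (forall z, 0 <= g z <= N)%R, (forall z, ~ S z -> g z = 0%R) &
    forall F : Z -> \bar R, measurable_fun setT F -> (forall z, 0 <= F z) ->
      \int[P]_z (F z * (g z)%:E) = \int[pi]_(w in K) F (a w)].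
Proof.
move=> mK [ma aE] mS N0 rN KS.
apply: restricted_image_density => // A mA AS.
rewrite aE//.
rewrite (Radon_Nikodym_SigmaFinite.f_integral (nu := prob_prod) prod_P mA).
rewrite -integral_cst//; apply: ge0_le_integral => //.
- by move=> z _; exact: Radon_Nikodym_SigmaFinite.f_ge0.
- exact: measurable_funTS mr.
- by move=> z Az; exact/rN/AS.
Qed.

(* Mass is moved from the points [b1 w], [b2 w] to [a1 w], [a2 w] for [w] in
   [K], which does not change the marginals. *)
Let truncated_exchange_null (K : set Om) (m M : R) : measurable K ->
  (0 < m)%R -> (0 < M)%R ->
  (forall w, K w -> [/\ (f (a1 w) <= M)%R, (f (a2 w) <= M)%R,
     (m <= f (b1 w) <= M)%R & (m <= f (b2 w) <= M)%R]) ->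
  (forall w, K w -> [/\ r (a1 w) <= M%:E, r (a2 w) <= M%:E,
     r (b1 w) <= M%:E & r (b2 w) <= M%:E]) ->
  (forall w, K w -> H (a1 w) + H (a2 w) < H (b1 w) + H (b2 w)) ->
  pi K = 0.
Proof.
move=> mK m0 M0 Kf Kr KH.
have m20 : (0 < m / 2)%R by rewrite divr_gt0.
have [C C0 [CM Cm]] := derive1_bounds h_C2 h'_0 (M + 1)%R m20.
(* Mass may be added where [f] vanishes, but is removed only where [f >= m], so that small
   perturbations stay nonnegative. *)
pose Sa : set Z := [set z | (f z <= M)%R] `&` [set z | r z <= M%:E].
pose Sb : set Z := [set z | (m <= f z)%R] `&` Sa.
have mSa : measurable Sa.
  apply: measurableI; rewrite -[X in measurable X]setTI.
    by apply: measurable_fun_le => //.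
  exact: emeasurable_fun_infty_c.
have mSb : measurable Sb.
  apply: measurableI => //; rewrite -[X in measurable X]setTI.
  by apply: measurable_fun_le.
have Sar z : Sa z -> r z <= M%:E by case.
have Sbr z : Sb z -> r z <= M%:E by case=> _ [].
have Ka1 w : K w -> Sa (a1 w).
  by move=> Kw; have [? _ _ _] := Kf w Kw; have [? _ _ _] := Kr w Kw.
have Ka2 w : K w -> Sa (a2 w).
  by move=> Kw; have [_ ? _ _] := Kf w Kw; have [_ ? _ _] := Kr w Kw.
have Kb1 w : K w -> Sb (b1 w).
  by move=> Kw; have [_ _ /andP[? ?] _] := Kf w Kw; have [_ _ ? _] := Kr w Kw.
have Kb2 w : K w -> Sb (b2 w).
  by move=> Kw; have [_ _ _ /andP[? ?]] := Kf w Kw; have [_ _ _ ?] := Kr w Kw.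
have [ga1 [mga1 ga1M ga1S ga1E]] := image_density mK a1P mSa M0 Sar Ka1.
have [ga2 [mga2 ga2M ga2S ga2E]] := image_density mK a2P mSa M0 Sar Ka2.
have [gb1 [mgb1 gb1M gb1S gb1E]] := image_density mK b1P mSb M0 Sbr Kb1.
have [gb2 [mgb2 gb2M gb2S gb2E]] := image_density mK b2P mSb M0 Sbr Kb2.
pose wp z := (ga1 z + ga2 z)%R; pose wm z := (gb1 z + gb2 z)%R.
have mwp : measurable_fun setT wp by exact: measurable_funD.
have mwm : measurable_fun setT wm by exact: measurable_funD.
have wpN z : (0 <= wp z <= M + M)%R.
  have /andP[? ?] := ga1M z; have /andP[? ?] := ga2M z.
  by rewrite addr_ge0//= lerD.
have wmN z : (0 <= wm z <= M + M)%R.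
  have /andP[? ?] := gb1M z; have /andP[? ?] := gb2M z.
  by rewrite addr_ge0//= lerD.
have intD (F : Z -> \bar R) (g1 g2 : Z -> R) (c1 c2 : Om -> Z) :
    measurable_fun setT F -> (forall z, 0 <= F z) ->
    measurable_fun setT g1 -> measurable_fun setT g2 ->
    (forall z, 0 <= g1 z <= M)%R -> (forall z, 0 <= g2 z <= M)%R ->
    image_prod c1 -> image_prod c2 ->
    \int[P]_z (F z * (g1 z)%:E) = \int[pi]_(w in K) F (c1 w) ->
    \int[P]_z (F z * (g2 z)%:E) = \int[pi]_(w in K) F (c2 w) ->
    \int[P]_z (F z * (g1 z + g2 z)%:E) =
    \int[pi]_(w in K) (F (c1 w) + F (c2 w)).
  move=> mF F0 mg1 mg2 g1M g2M [mc1 _] [mc2 _] E1 E2.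
  rewrite ge0_integralD//; last 2 first.
  - by apply: measurable_funTS; exact: measurableT_comp.
  - by apply: measurable_funTS; exact: measurableT_comp.
  rewrite -E1 -E2 -ge0_integralD//.
  - apply: eq_integral => z _; rewrite EFinD ge0_muleDr ?lee_fin//.
    + by case/andP: (g1M z).
    + by case/andP: (g2M z).
  - by move=> z _; rewrite mule_ge0// lee_fin; case/andP: (g1M z).
  - by apply: emeasurable_funM => //; exact/measurable_EFinP.
  - by move=> z _; rewrite mule_ge0// lee_fin; case/andP: (g2M z).
  - by apply: emeasurable_funM => //; exact/measurable_EFinP.
have wpE (F : Z -> \bar R) : measurable_fun setT F -> (forall z, 0 <= F z) ->
    \int[P]_z (F z * (wp z)%:E) = \int[pi]_(w in K) (F (a1 w) + F (a2 w)).
  by move=> mF F0; apply: intD => //; [exact: ga1E|exact: ga2E].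
have wmE (F : Z -> \bar R) : measurable_fun setT F -> (forall z, 0 <= F z) ->
    \int[P]_z (F z * (wm z)%:E) = \int[pi]_(w in K) (F (b1 w) + F (b2 w)).
  by move=> mF F0; apply: intD => //; [exact: gb1E|exact: gb2E].
pose G z : \bar R := maxe 0 (C%:E - H z).
have mG : measurable_fun setT G.
  by apply: measurable_maxe => //; exact: emeasurable_funB.
have G0 z : 0 <= G z by rewrite le_max lexx.
have GE z : (f z <= M)%R -> G z = C%:E - H z.
  move=> fM; rewrite /G max_r// /H.
  have /predU1P[<-|fz0] : (0%R == f z) || (0 < f z)%R by rewrite -le_eqVlt.
    by rewrite derive_ext0// leey.
  by rewrite derive_ext_pos// -EFinB lee_fin subr_ge0 CM// fz0 ler_wpDr.
(* Integrals over [D] become integrals of indicators over the corners. For strips the indicator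
   depends on one coordinate, and the added and removed corners share these coordinates. *)
have marginal (D : set Z) : measurable D ->
    (forall w, (\1_D (a1 w) + \1_D (a2 w) = \1_D (b1 w) + \1_D (b2 w) :> R)%R) ->
    \int[P]_(z in D) (wp z)%:E = \int[P]_(z in D) (wm z)%:E.
  move=> mD DE.
  have restrE (k : Z -> R) : \int[P]_(z in D) (k z)%:E =
      \int[P]_z ((\1_D z)%:E * (k z)%:E).
    rewrite integral_mkcond; apply: eq_integral => z _.
    by rewrite epatch_indic /= muleC.
  have mD1 : measurable_fun setT (EFin \o (\1_D : Z -> R)).
    exact/measurable_EFinP.
  rewrite !restrE wpE// ?wmE//; try by move=> z; rewrite lee_fin.
  by apply: eq_integral => w _; rewrite /= -!EFinD DE.
have foc : \int[P]_z (G z * (wp z)%:E) <= \int[P]_z (G z * (wm z)%:E).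
  apply: (@first_order_condition _ _ _ P h h_cont h_C2 h'_0 f wp wm m M C (M + M)) => //.
  - by rewrite addr_ge0// ltW.
  - move=> z; have [[fM _]|Sz] := pselect (Sa z); first by [].
    by rewrite /wp ga1S// ga2S// addr0 eqxx.
  - move=> z; have [[mfz [fM _]]|Sz] := pselect (Sb z); first by rewrite mfz.
    by rewrite /wm gb1S// gb2S// addr0 eqxx.
  - by rewrite marginal// => w; rewrite !indicT.
  - move=> e e0 fe0.
    under [in leRHS]eq_integral do rewrite mulrBr.
    have scaleE (D : set Z) (k : Z -> R) : measurable D ->
        measurable_fun setT k -> (forall z, 0 <= k z)%R ->
        \int[P]_(z in D) (e * k z)%:E = e%:E * \int[P]_(z in D) (k z)%:E.
      move=> mD mk k0; under eq_integral do rewrite EFinM.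
      rewrite ge0_integralZl//.
      - by apply/measurable_EFinP; exact: measurable_funTS.
      - by move=> z _; rewrite lee_fin.
      - by rewrite lee_fin ltW.
    have wp0 z : (0 <= wp z)%R by have /andP[] := wpN z.
    have wm0 z : (0 <= wm z)%R by have /andP[] := wmN z.
    apply: (@optimizer_perturbation _ _ _ mu nu P Qs h _ _ (e * (M + M))) => //.
    + exact: measurable_nneg.
    + exact: measurable_funM.
    + exact: measurable_funM.
    + by move=> z; have /andP[? ?] := wpN z; rewrite (mulr_ge0 (ltW e0))//= ler_pM2l.
    + by move=> z; have /andP[? ?] := wmN z; rewrite (mulr_ge0 (ltW e0))//= ler_pM2l.
    + by move=> z; rewrite -mulrBr.
    + move=> A mA; rewrite !scaleE//; try exact: measurableX.
      rewrite marginal//; first exact: measurableX.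
      move=> w; have XD c : (\1_(A `*` [set: borel Y]) c = \1_A c.1 :> R)%R.
        by rewrite !indicE; congr (nat_of_bool _)%:R%R; apply/idP/idP;
          rewrite !inE => // -[].
      by rewrite !XD X1 X2.
    + move=> B mB; rewrite !scaleE//; try exact: measurableX.
      rewrite marginal//; first exact: measurableX.
      move=> w; have YD c : (\1_([set: borel X] `*` B) c = \1_B c.2 :> R)%R.
        by rewrite !indicE; congr (nat_of_bool _)%:R%R; apply/idP/idP;
          rewrite !inE => // -[].
      by rewrite !YD Y1 Y2 addrC.
have m2m : (m / 2 <= m)%R by lra.
have M1M : (M <= M + 1)%R by lra.
have Kb w : K w -> exists k1 k2 : R, [/\ H (b1 w) = k1%:E, H (b2 w) = k2%:E,
    (- C <= k1)%R & (- C <= k2)%R].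
  move=> Kw; have [_ _ /andP[m1 M1] /andP[m2 M2]] := Kf w Kw.
  exists (derive1 h (f (b1 w))), (derive1 h (f (b2 w))).
  by split; rewrite /H ?derive_ext_pos ?(lt_le_trans m0 m1) ?(lt_le_trans m0 m2)//;
    by apply: Cm; rewrite (le_trans m2m)// (le_trans _ M1M).
have mGc (c : Om -> Z) : image_prod c -> measurable_fun K (fun w => G (c w)).
  by move=> [mc _]; apply: measurable_funTS; exact: measurableT_comp.
pose Gb w := G (b1 w) + G (b2 w); pose Ga w := G (a1 w) + G (a2 w).
(* The hypothesis on [K] makes [Gb < Ga] there, whereas [foc] orders the integrals the other way. *)
apply: (@null_of_integral_le _ _ _ pi K Gb Ga); first exact: mK.
- by apply: emeasurable_funD; exact: mGc.
- by apply: emeasurable_funD; exact: mGc.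
- by move=> w _; rewrite adde_ge0.
- move=> w Kw; have [fa1 fa2 /andP[_ fb1] /andP[_ fb2]] := Kf w Kw.
  rewrite /Gb /Ga !GE//; have [k1 [k2 [H1 H2 _ _]]] := Kb w Kw.
  rewrite H1 H2; apply: lte_sub_sum; [exact: derive_ext_lty..|].
  by have := KH w Kw; rewrite H1 H2.
- by rewrite (wpE G mG G0) (wmE G mG G0) in foc; exact: foc.
(* On [K] the derivative at [b1 w] and [b2 w] is at least [- C], so each of the two values of [G] is
   at most [2 * C]. *)
- apply: (@le_lt_trans _ _ (\int[pi]_(w in K) (cst (4 * C)%:E w))).
    apply: ge0_le_integral => //.
    + by move=> w _; rewrite adde_ge0.
    + by apply: emeasurable_funD; exact: mGc.
    + move=> w Kw; have [_ _ /andP[_ fb1] /andP[_ fb2]] := Kf w Kw.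
      rewrite /Gb !GE//; have [k1 [k2 [-> -> ? ?]]] := Kb w Kw.
      by rewrite -!(EFinB, EFinD) lee_fin; lra.
  by rewrite integral_cst// ltey_eq fin_numM// fin_num_measure.
Qed.

Let mrf : measurable_fun setT (fun z => fine (r z)).
Proof. exact: measurableT_comp. Qed.

Let rE z : r z = (fine (r z))%:E.
Proof.
by rewrite fineK//; exact: (Radon_Nikodym_SigmaFinite.f_fin_num
  (nu := prob_prod) prod_P).
Qed.

Let rf0 z : (0 <= fine (r z))%R.
Proof.
by rewrite fine_ge0//; exact: (Radon_Nikodym_SigmaFinite.f_ge0
  (nu := prob_prod) prod_P).
Qed.

Lemma measurable_improving_exchange :
  measurable [set w | [/\ (0 < f (b1 w))%R, (0 < f (b2 w))%R &
                  H (a1 w) + H (a2 w) < H (b1 w) + H (b2 w)]].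
Proof.
have [[ma1 _] [ma2 _]] := (a1P, a2P); have [[mb1 _] [mb2 _]] := (b1P, b2P).
rewrite (_ : [set w | _] = [set w | (0 < f (b1 w))%R] `&`
  [set w | (0 < f (b2 w))%R] `&`
  [set w | H (a1 w) + H (a2 w) < H (b1 w) + H (b2 w)]); last first.
  by apply/seteqP; split=> w /= [] // [].
apply: measurableI; first apply: measurableI.
- rewrite -[X in measurable X]setTI.
  apply: (@emeasurable_fun_o_infty _ _ _ _ (fun w => (f (b1 w))%:E) _ _ 0) => //.
  by apply/measurable_EFinP; exact: measurableT_comp.
- rewrite -[X in measurable X]setTI.
  apply: (@emeasurable_fun_o_infty _ _ _ _ (fun w => (f (b2 w))%:E) _ _ 0) => //.
  by apply/measurable_EFinP; exact: measurableT_comp.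
- rewrite -[X in measurable X]setTI; apply: measurable_lte => //.
    by apply: emeasurable_funD; exact: measurableT_comp.
  by apply: emeasurable_funD; exact: measurableT_comp.
Qed.

(* The strict inequality includes the case where the left-hand side is [-oo],
   i.e., where the density vanishes at [a1 w] or [a2 w]. *)
Lemma exchange_null :
  pi [set w | [/\ (0 < f (b1 w))%R, (0 < f (b2 w))%R &
                  H (a1 w) + H (a2 w) < H (b1 w) + H (b2 w)]] = 0.
Proof.
have [[ma1 _] [ma2 _]] := (a1P, a2P); have [[mb1 _] [mb2 _]] := (b1P, b2P).
set K := [set w | _].
have mK : measurable K := measurable_improving_exchange.
(* All eight summands are nonnegative, so a bound on [B] bounds each of them. *)
pose B w := (f (a1 w) + f (a2 w) + f (b1 w) + f (b2 w) + fine (r (a1 w)) +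
  fine (r (a2 w)) + fine (r (b1 w)) + fine (r (b2 w)))%R.
have mB : measurable_fun setT B.
  have mfc (c : Om -> Z) : measurable_fun setT c ->
    measurable_fun setT (fun w => f (c w)) by exact: measurableT_comp.
  have mrc (c : Om -> Z) : measurable_fun setT c ->
    measurable_fun setT (fun w => fine (r (c w))) by exact: (measurableT_comp mrf).
  by do 7?apply: measurable_funD; first [exact: mfc|exact: mrc].
pose L (b : Om -> Z) n := [set w | (n.+1%:R^-1 <= f (b w))%R].
have mL b n : measurable_fun setT b -> measurable (L b n).
  move=> mb; rewrite -[X in measurable X]setTI; apply: measurable_fun_le => //.
  exact: measurableT_comp.
pose K_ n := K `&` [set w | (B w <= n.+1%:R)%R] `&` (L b1 n `&` L b2 n).
have mK_ n : measurable (K_ n).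
  apply: measurableI; apply: measurableI => //; [|exact: mL..].
  by rewrite -[X in measurable X]setTI; exact: measurable_fun_le.
have K_0 n : pi (K_ n) = 0.
  apply: (@truncated_exchange_null (K_ n) n.+1%:R^-1 n.+1%:R) => //.
  - move=> w [[_ Bn] [L1 L2]]; rewrite /= /B in Bn; rewrite /L /= in L1 L2.
    rewrite L1 L2.
    have ? := f0 (a1 w); have ? := f0 (a2 w); have ? := f0 (b1 w).
    have ? := f0 (b2 w); have ? := rf0 (a1 w); have ? := rf0 (a2 w).
    have ? := rf0 (b1 w); have ? := rf0 (b2 w).
    by split; lra.
  - move=> w [[_ Bn] _]; rewrite /= /B in Bn.
    have ? := f0 (a1 w); have ? := f0 (a2 w); have ? := f0 (b1 w).
    have ? := f0 (b2 w); have ? := rf0 (a1 w); have ? := rf0 (a2 w).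
    have ? := rf0 (b1 w); have ? := rf0 (b2 w).
    by split; rewrite rE lee_fin; lra.
  - by move=> w [[[_ _ +] _] _].
have KE : K `<=` \bigcup_n K_ n.
  move=> w Kw; have [fb1 fb2 _] := Kw.
  (* A level above [s] dominates [B w] and has its inverse below both removed-corner densities. *)
  pose s := Num.max (B w) (Num.max (f (b1 w))^-1 (f (b2 w))^-1)%R.
  have : (s <= (Num.truncn s).+1%:R)%R by rewrite ltW// truncnS_gt.
  rewrite {1}/s !ge_max => /and3P[Bs s1 s2].
  exists (Num.truncn s) => //; split; first by split.
  by split; rewrite /L /= -[leRHS]invrK lef_pV2 ?posrE ?invr_gt0.
apply: (@measure_negligible _ _ _ pi) => //; apply: negligibleS KE _.
apply: negligible_bigcup => n; exists (K_ n).
by split; [exact: mK_|exact: K_0|exact: subset_refl].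
Qed.

End exchange.

(** * Positivity of the optimal density *)

Lemma measurable_null_setU d (T : measurableType d) (R : realType)
    (m : {measure set T -> \bar R}) (A B : set T) :
  measurable A /\ m A = 0 -> measurable B /\ m B = 0 ->
  measurable (A `|` B) /\ m (A `|` B) = 0.
Proof.
by move=> [mA A0] [mB B0]; split; [exact: measurableU|exact: null_set_setU].
Qed.

(** The product measure of [N] is the integral of the measures of its sections. *)
Lemma ae_xsection_null d1 d2 (T1 : measurableType d1) (T2 : measurableType d2)
    (R : realType) (m1 : probability T1 R) (m2 : probability T2 R)
    (N : set (T1 * T2)) :
  measurable N -> (m1 \x m2) N = 0 ->
  m1.-negligible [set x | m2 (xsection N x) != 0].
Proof.
move=> mN N0.
have mx : measurable_fun setT (fun x => m2 (xsection N x)).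
  exact: measurable_fun_xsection.
have : \int[m1]_x `|m2 (xsection N x)| = 0.
  by rewrite -[RHS]N0; apply: eq_integral => x _; rewrite gee0_abs.
move=> /(ae_eq_integral_abs _ measurableT mx) [M [mM M0 NM]].
exists M; split=> // x /= /negP xN; apply: NM => /= /(_ Logic.I)/eqP.
exact: xN.
Qed.

(** A product measure is determined by its values on rectangles; [restricted_image] over the full
    set supplies the law of [a] as a measure. *)
Lemma image_prod_rect (R : realType) (X Y : ptopologicalType)
    (mu : probability (borel X) R) (nu : probability (borel Y) R)
    d (Om : measurableType d) (pi : probability Om R)
    (a : Om -> borel X * borel Y) :
  measurable_fun setT a ->
  (forall A B, measurable A -> measurable B ->
    pi (a @^-1` (A `*` B)) = mu A * nu B) ->
  image_prod mu nu pi a.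
Proof.
move=> ma aE; split=> // A mA.
pose a' : {mfun Om >-> (borel X * borel Y)%type} :=
  HB.pack a (isMeasurableFun.Build _ _ _ _ _ ma).
rewrite (@product_measure_unique _ _ _ _ _ mu nu
  (restricted_image pi measurableT a')) //.
  by rewrite /restricted_image /= /pushforward /mrestr setIT.
move=> B C mB mC; rewrite -aE//.
by rewrite /restricted_image /= /pushforward /mrestr setIT.
Qed.

Section exchanged_points.
Context (R : realType) (X Y : ptopologicalType).
Context (mu : probability (borel X) R) (nu : probability (borel Y) R).
Local Notation Z := (borel X * borel Y)%type.
Let m : probability Z R := mu \x nu.
Let pi : probability (Z * Z)%type R := m \x m.

Definition swap12 (w : Z * Z) : Z := (w.1.1, w.2.2).
Definition swap21 (w : Z * Z) : Z := (w.2.1, w.1.2).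

Let mE A B : measurable A -> measurable B -> m (A `*` B) = mu A * nu B.
Proof. by move=> mA mB; exact: product_measure1E. Qed.

Let piE U V : measurable U -> measurable V -> pi (U `*` V) = m U * m V.
Proof. by move=> mU mV; exact: product_measure1E. Qed.

Lemma image_prod_fst : image_prod mu nu pi fst.
Proof.
apply: image_prod_rect; first exact: measurable_fst.
move=> A B mA mB; rewrite (_ : _ @^-1` _ = (A `*` B) `*` setT); last first.
  by apply/seteqP; split=> w //= [].
by rewrite piE//; [rewrite probability_setT mule1 mE|exact: measurableX].
Qed.

Lemma image_prod_snd : image_prod mu nu pi snd.
Proof.
apply: image_prod_rect; first exact: measurable_snd.
move=> A B mA mB; rewrite (_ : _ @^-1` _ = setT `*` (A `*` B)); last first.
  by apply/seteqP; split=> w //= [].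
by rewrite piE//; [rewrite probability_setT mul1e mE|exact: measurableX].
Qed.

(** The four coordinates are independent under [pi], so recombining a first with a second coordinate
    keeps the law. *)
Lemma image_prod_swap12 : image_prod mu nu pi swap12.
Proof.
apply: image_prod_rect.
  by apply: measurable_fun_pair; apply: measurableT_comp.
move=> A B mA mB.
rewrite (_ : _ @^-1` _ = (A `*` setT) `*` (setT `*` B)); last first.
  by apply/seteqP; split=> w; rewrite /setX /=; tauto.
rewrite piE//; [|exact: measurableX..].
by rewrite !mE// !probability_setT mul1e mule1.
Qed.

Lemma image_prod_swap21 : image_prod mu nu pi swap21.
Proof.
apply: image_prod_rect.
  by apply: measurable_fun_pair; apply: measurableT_comp.
move=> A B mA mB.
rewrite (_ : _ @^-1` _ = (setT `*` B) `*` (A `*` setT)); last first.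
  by apply/seteqP; split=> w; rewrite /setX /=; tauto.
rewrite piE//; [|exact: measurableX..].
by rewrite !mE// !probability_setT mul1e mule1 muleC.
Qed.

End exchanged_points.

Section positivity.
Context (R : realType) (X Y : ptopologicalType).
Context (mu : probability (borel X) R) (nu : probability (borel Y) R).
Variable P : probability (borel X * borel Y)%type R.
Hypothesis P_prod : P `<< (mu \x nu).
Variable Qs : probability (borel X * borel Y)%type R.
Hypothesis QsP : Qs `<< P.
Hypothesis Qs_cpl : cpl mu nu Qs.
Local Notation Z := (borel X * borel Y)%type.
Let f : Z -> R := density Qs P.
Let m : probability Z R := mu \x nu.

Let mE A B : measurable A -> measurable B -> m (A `*` B) = mu A * nu B.
Proof. by move=> mA mB; exact: product_measure1E. Qed.

Let F := [set z | (0 < f z)%R].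

Let mF : measurable F.
Proof. exact: measurable_density_gt0. Qed.

Let Qs_compl : Qs (~` F) = 0.
Proof.
rewrite (density_integral QsP (measurableC mF)); apply: integral0_eq => z /=.
move=> /negP; rewrite -leNgt => fz; congr EFin; apply/eqP.
by rewrite eq_le fz density_ge0.
Qed.

(** [Qs] is carried by [F], and inherits null sets from the product through [P]. *)
Let Qs_null (D : set Z) : measurable D -> m (D `&` F) = 0 -> Qs D = 0.
Proof.
move=> mD DF.
have mDF : measurable (D `&` F) by exact: measurableI.
have QDF : Qs (D `&` F) = 0.
  move/null_content_dominatesP : QsP; apply => //.
  by move/null_content_dominatesP : P_prod; apply.
apply: (@subset_measure0 _ _ _ Qs D ((D `&` F) `|` ~` F)) => //.
- by apply: measurableU => //; exact: measurableC.
- by move=> z Dz; have [Fz|Fz] := pselect (F z); [left|right].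
- by apply: null_set_setU => //; exact: measurableC.
Qed.

Let measurable_null_xsection : measurable [set x | nu (xsection F x) = 0].
Proof.
have := measurable_fun_xsection nu mF => /(_ measurableT [set 0]).
by rewrite setTI; apply.
Qed.

Let measurable_null_ysection : measurable [set y | mu (ysection F y) = 0].
Proof.
have := measurable_fun_ysection mu mF => /(_ measurableT [set 0]).
by rewrite setTI; apply.
Qed.

(** Over these [x] the set [F] has null sections, so the strip meets [F] in a product-null set and
    is not charged by [Qs], whose first marginal is [mu]. *)
Lemma null_xsection_support : mu [set x | nu (xsection F x) = 0] = 0.
Proof.
set A := [set x | _]; have mA : measurable A := measurable_null_xsection.
rewrite -(Qs_cpl.1 A mA) /pushforward.
have -> : fst @^-1` A = A `*` [set: borel Y].
  by apply/seteqP; split=> z //= [].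
apply: Qs_null; first exact: measurableX.
apply: integral0_eq => x _ /=; rewrite xsectionI.
have [Ax|Ax] := pselect (A x).
  by rewrite in_xsectionX ?inE// setTI.
by rewrite notin_xsectionX ?notin_setE// set0I.
Qed.

Lemma null_ysection_support : nu [set y | mu (ysection F y) = 0] = 0.
Proof.
set B := [set y | _]; have mB : measurable B := measurable_null_ysection.
rewrite -(Qs_cpl.2 B mB) /pushforward.
have -> : snd @^-1` B = [set: borel X] `*` B.
  by apply/seteqP; split=> z //= [].
have mTB : measurable ([set: borel X] `*` B) by exact: measurableX.
apply: Qs_null => //.
(* The reverse order of integration computes the product measure through sections at fixed [y]. *)
rewrite /m /= (@product_measure_unique _ _ _ _ _ mu nu (mu \x^ nu)); last 2 first.
- by move=> C D mC mD; exact: product_measure2E.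
- exact: measurableI.
apply: integral0_eq => y _ /=; rewrite ysectionI.
have [By|By] := pselect (B y).
  by rewrite in_ysectionX ?inE// setTI.
by rewrite notin_ysectionX ?notin_setE// set0I.
Qed.

(* For almost every point [(x, y)] where the density vanishes, the points
   [(x, y')] and [(x', y)] of positive density form a non-null set of pairs
   [(x', y')]. *)
Lemma null_zero_set (N : set (Z * Z)) : measurable N -> (m \x m) N = 0 ->
  (forall w, ~ F w.1 -> F (swap12 w) -> F (swap21 w) -> N w) -> m (~` F) = 0.
Proof.
move=> mN N0 FN.
apply: measure_negligible; first exact: measurableC.
have NA := ae_xsection_null mN N0.
have negA : m.-negligible ([set x | nu (xsection F x) = 0] `*` setT).
  have mA := measurable_null_xsection.
  exists ([set x | nu (xsection F x) = 0] `*` setT); split => //.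
    exact: measurableX.
  by rewrite mE// null_xsection_support mul0e.
have negB : m.-negligible (setT `*` [set y | mu (ysection F y) = 0]).
  have mB := measurable_null_ysection.
  exists (setT `*` [set y | mu (ysection F y) = 0]); split => //.
    exact: measurableX.
  by rewrite mE// null_ysection_support mule0.
apply: (negligibleS _ (negligibleU (negligibleU NA negA) negB)).
move=> [x y] Fz.
have [nux|nux] := pselect (nu (xsection F x) = 0); first by left; right.
have [muy|muy] := pselect (mu (ysection F y) = 0); first by right.
left; left => /=; apply/negP => /eqP Nz.
(* This rectangle of pairs [(x', y')] lies in the null section of [N], yet both its sides have
   positive measure. *)
have : m (ysection F y `*` xsection F x) = 0.
  apply: (subset_measure0 _ _ _ Nz).
  - by apply: measurableX; [exact: measurable_ysection|exact: measurable_xsection].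
  - exact: measurable_xsection.
  - move=> [x' y'] [/= /set_mem Fx' /set_mem Fy']; apply/mem_set.
    exact: (FN ((x, y), (x', y'))).
rewrite mE//; last 2 first.
- exact: measurable_ysection.
- exact: measurable_xsection.
by move/eqP; rewrite mule_eq0 => /orP[/eqP|/eqP].
Qed.

End positivity.

(* Equivalence of the measures and construction of the potentials *)
Local Close Scope ereal_scope.

Theorem theorem1p4 (R : realType) (X Y : ptopologicalType)
  (polishX : polish R X) (polishY : polish R Y)
  (mu : probability (borel X) R) (nu : probability (borel Y) R)
  (P : probability (borel X * borel Y)%type R)
  (P_equiv : equivalent_measures P (mu \x nu)%E)
  (h : R -> R)
  (h_cont : {within `[0, +oo[%classic, continuous h})
  (h_C2 : C2_pos h)
  (h'_0 : h^`() x @[x --> 0^'+] --> -oo%R)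
  (h'_oo : h^`() x @[x --> +oo%R] --> +oo%R)
  (h''_inf : (-oo < ereal_inf [set (h^`(2)%classic x)%:E | x in `]0%R, +oo[%classic])%E)
  (finite_value : problem_value h P mu nu \is a fin_num)
  (Qs : probability (borel X * borel Y)%type R)
  (Qs_opt : optimizer h P mu nu Qs) :
  equivalent_measures Qs P /\
  exists (phi : borel X -> \bar R) (psi : borel Y -> \bar R),
    [/\ measurable_fun setT phi, measurable_fun setT psi,
        (forall x, phi x < +oo)%E, (forall y, psi y < +oo)%E &
        {ae P, forall z, derive_ext h (density Qs P z) = (phi z.1 + psi z.2)%E}].
Proof.
have [P_prod prod_P] := P_equiv.
have [Qs_cpl QsE] := Qs_opt.
(* A finite value excludes the branch of [objective] with value [+oo]. *)
have [QsP hf_fin] : Qs `<< P /\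
    (\int[P]_z (h (density Qs P z))%:E)%E \is a fin_num.
  move: finite_value; rewrite -QsE /objective.
  by case: asboolP.
pose Z := (borel X * borel Y)%type.
pose m : probability Z R := (mu \x nu)%E.
pose pi : probability (Z * Z)%type R := (m \x m)%E.
pose f : Z -> R := density Qs P.
pose H z := derive_ext h (f z).
have f0 z : 0 <= f z by exact: density_ge0.
have mf : measurable_fun setT f := density_measurable QsP.
have mH : measurable_fun setT H by exact: measurable_derive_ext_comp.
have p1 := image_prod_fst mu nu; have p2 := image_prod_snd mu nu.
have p12 := image_prod_swap12 mu nu; have p21 := image_prod_swap21 mu nu.
(* [N1] and [N2] collect the pairs for which one of the two opposite exchanges would improve the
   objective. *)
pose N1 := [set w : Z * Z | [/\ 0 < f (swap12 w), 0 < f (swap21 w) &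
  (H w.1 + H w.2 < H (swap12 w) + H (swap21 w))%E]].
pose N2 := [set w : Z * Z | [/\ 0 < f w.1, 0 < f w.2 &
  (H (swap12 w) + H (swap21 w) < H w.1 + H w.2)%E]].
have mN1 : measurable N1.
  exact: (measurable_improving_exchange h_C2 QsP p1 p2 p12 p21).
have mN2 : measurable N2.
  exact: (measurable_improving_exchange h_C2 QsP p12 p21 p1 p2).
have N1_0 : pi N1 = 0%E.
  exact: (exchange_null prod_P h_cont h_C2 h'_0 QsP Qs_opt hf_fin p1 p2 p12 p21).
have N2_0 : pi N2 = 0%E.
  exact: (exchange_null prod_P h_cont h_C2 h'_0 QsP Qs_opt hf_fin p12 p21 p1 p2).
pose F := [set z | 0 < f z].
have fNF z : ~ F z -> f z = 0.
  by move=> /negP; rewrite -leNgt => fz; apply/eqP; rewrite eq_le fz f0.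
have mF : measurable F by exact: measurable_density_gt0.
have F0 : m (~` F) = 0%E.
  apply: (null_zero_set P_prod QsP Qs_cpl mN1 N1_0) => w /fNF fw Fw1 Fw2.
  (* [H w.1 = -oo] absorbs [H w.2], while the right-hand side is finite. *)
  by split; rewrite // /H fw derive_ext0// addNye !derive_ext_pos// -EFinD ltNyr.
have PF0 : P (~` F) = 0%E.
  by move/null_content_dominatesP : P_prod; apply => //; exact: measurableC.
split.
  split=> //; apply/null_content_dominatesP => A mA QA.
  have mAF : measurable (A `&` F) by exact: measurableI.
  (* The density is positive on this set but has integral zero over it. *)
  have PAF : P (A `&` F) = 0%E.
    apply: (@null_of_integral_le _ _ _ P _ (cst 0%E) (fun z => (f z)%:E)) => //.
    - by apply/measurable_EFinP; exact: measurable_funTS.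
    - by move=> z [_ Fz]; rewrite lte_fin.
    - rewrite -density_integral// integral_cst// mul0e.
      by rewrite -QA le_measure ?inE//; exact: subIsetl.
    - by rewrite integral_cst// mul0e.
  apply: (@subset_measure0 _ _ _ P A ((A `&` F) `|` ~` F)) => //.
  - by apply: measurableU => //; exact: measurableC.
  - by move=> z Az; have [Fz|Fz] := pselect (F z); [left|right].
  - by apply: null_set_setU => //; exact: measurableC.
pose null S := measurable S /\ pi S = 0%E.
have nullU S1 S2 : null S1 -> null S2 -> null (S1 `|` S2).
  exact: measurable_null_setU.
have null_pre (c : Z * Z -> Z) :
    image_prod mu nu pi c -> null (c @^-1` (~` F)).
  move=> [mc cE]; have mFC : measurable (~` F) by exact: measurableC.
  split; last by rewrite cE.
  by rewrite -[X in measurable X]setTI; exact: mc.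
(* Outside [N1], [N2] and the zeros of [f] at the four corners, both strict inequalities fail and
   equality remains. *)
have [N [mN N0 NP]] : exists N : set (Z * Z), [/\ measurable N, pi N = 0%E &
    forall w, ~ N w -> [/\ 0 < f w.1, 0 < f (swap12 w), 0 < f (swap21 w) &
      (H w.1 + H w.2 = H (swap12 w) + H (swap21 w))%E]].
  exists (N1 `|` N2 `|` (fst @^-1` (~` F) `|` snd @^-1` (~` F)) `|`
    ((@swap12 X Y) @^-1` (~` F) `|` (@swap21 X Y) @^-1` (~` F))).
  have [? ?] := nullU _ _ (nullU _ _ (nullU _ _ (conj mN1 N1_0) (conj mN2 N2_0))
    (nullU _ _ (null_pre _ p1) (null_pre _ p2)))
    (nullU _ _ (null_pre _ p12) (null_pre _ p21)).
  split=> //.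
  move=> w /not_orP[/not_orP[/not_orP[n1 n2] /not_orP[F1 F2]] /not_orP[F3 F4]].
  have {}F1 : 0 < f w.1 by exact: contrapT.
  have {}F2 : 0 < f w.2 by exact: contrapT.
  have {}F3 : 0 < f (swap12 w) by exact: contrapT.
  have {}F4 : 0 < f (swap21 w) by exact: contrapT.
  split=> //; apply/eqP; rewrite eq_le !leNgt.
  by apply/andP; split; apply/negP => lt; [apply: n2|apply: n1].
have mT : m setT = 1%E := probability_setT m.
(* Almost every base point has a null section, and the total mass 1 ensures that one exists. *)
have [z0 z0N] : exists z0, m (xsection N z0) = 0%E.
  apply: contrapT => /forallNP NN.
  have : m.-negligible [set: Z].
    by apply: negligibleS (ae_xsection_null mN N0) => z _; exact/eqP/NN.
  move=> /(measure_negligible measurableT) m0.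
  by have /eqP := etrans (esym mT) m0; rewrite onee_eq0.
have mNz : measurable (xsection N z0) by exact: measurable_xsection.
have aeP z : ~ xsection N z0 z -> ~ N (z0, z).
  by move=> zN Nz; apply: zN; exact/mem_set.
(* Any [z] outside the section would give [f z0 > 0], so otherwise the null section would be the
   whole space. *)
have fz0 : 0 < f z0.
  apply: contrapT => fz0.
  have m0 : m [set: Z] = 0%E.
    apply: (subset_measure0 _ _ _ z0N) => // z _.
    by apply: contrapT => /aeP/NP[].
  by have /eqP := etrans (esym mT) m0; rewrite onee_eq0.
have Hpos z : 0 < f z -> H z = (derive1 h (f z))%:E.
  by move=> ?; rewrite /H derive_ext_pos.
have Hlty z : (H z < +oo)%E by exact: derive_ext_lty.
(* With [z0 = (x0, y0)] and [z = (x, y)], the identity reads [H z0 + H z = H (x0, y) + H (x, y0)]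
   and is solved for [H z], as [H z0] is finite. The potentials are [-oo] where [f] vanishes on the
   lines through [z0]. *)
exists (fun x => H (x, z0.2)), (fun y => H (z0.1, y) - H z0)%E; split.
- by apply: (measurableT_comp mH); exact: measurable_fun_pair.
- apply: emeasurable_funB => //.
  by apply: (measurableT_comp mH); exact: measurable_fun_pair.
- by move=> x; exact: Hlty.
- move=> y; rewrite (Hpos _ fz0); move: (Hlty (z0.1, y)).
  by case: (H _) => //= r _; rewrite -EFinB ltry.
exists (xsection N z0); split=> //.
  by move/null_content_dominatesP : P_prod; apply.
move=> z /=; apply: contra_notP => /aeP/NP[_ f12 f21 /=].
rewrite /swap12 /swap21 /= in f12 f21 *.
rewrite -/(H z) (Hpos _ fz0) (Hpos _ f12) (Hpos _ f21).
case: (H z) => [r||] //; rewrite -!(EFinB, EFinD) => -[] ?.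
by congr EFin; lra.
Qed.
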